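(* Let $a$ be a real number with $a \geq 2$. For every real number $b \in [0, 2/a]$ there is a Cantor-like set $E \subseteq [0,1]$ with Hausdorff dimension equal to $b$ such that, for the uniform measure on $E$, almost all real numbers have irrationality exponent equal to $a$ (that is, if $\mu$ denotes the uniform measure on $E$, then $\mu$-almost every $x$ has irrationality exponent exactly $a$).
   Context: **Irrationality exponent.** The irrationality exponent of a real number $x$ is the supremum of the set of real numbers $z$ for which the inequality $0 < \left| x - \frac{p}{q}\right| < \frac{1}{q^z}$ is satisfied by infinitely many integer pairs $(p,q)$ with $q>0$. **Hausdorff dimension.** For $X \subseteq \mathbb{R}$, $s \geq 0$ and $\delta > 0$, let $H^s_\delta(X)$ be the infimum of $\sum_{j \geq 1} d_j^s$ over all countable covers of $X$ by balls with diameters $d_j < \delta$. The $s$-dimensional Hausdorff measure of $X$ is $\lim_{\delta \to 0} H^s_\delta(X)$, and the Hausdorff dimension of $X$ is the infimum of the $s \geq 0$ such that the $s$-dimensional Hausdorff measure of $X$ is zero. **Cantor-like set and its uniform measure.** A Cantor-like set is a set of the form $E = \bigcap_{k \geq 0} E_k$, where $E_0 = [0,1]$ and, for each $k \geq 1$, $E_k \subseteq E_{k-1}$ is a finite union of pairwise disjoint non-degenerate closed intervals (the level-$k$ intervals), each contained in a level-$(k-1)$ interval, such that all level-$(k-1)$ intervals contain the same number $i_k \geq 1$ of level-$k$ intervals, and the maximal length of the level-$k$ intervals tends to $0$ as $k \to \infty$. (The value $i_k = 1$ is allowed, so a singleton may occur as a degenerate case.) The uniform measure on $E$ (with respect to this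 construction) is the unique Borel probability measure $\mu$ supported on $E$ that assigns mass $1/(i_1 \cdots i_k)$ to each level-$k$ interval, for every $k\ge 1$. The assertion that there is a Cantor-like set means that there is a set together with such a construction, and ''the uniform measure'' refers to that construction. *)

(* Defs.v *)
From HB Require Import structures.
From mathcomp Require Import all_boot all_order all_algebra finmap.
From mathcomp Require Import all_classical all_reals all_analysis.

Set Implicit Arguments.
Unset Strict Implicit.
Unset Printing Implicit Defensive.

Import Order.TTheory GRing.Theory Num.Theory.
Import numFieldTopology.Exports numFieldNormedType.Exports.

Local Open Scope classical_set_scope.
Local Open Scope ring_scope.

(* The supremum is taken in the extended reals: it is +oo for Liouville
   numbers. Pairs (p, q) need not be reduced. *)
Definition irrationality_exponent (R : realType) (x : R) : \bar R :=
  ereal_sup [set z%:E | z in [set z : R |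
    infinite_set [set pq : int * int | 0 < pq.2 /\
      0 < `|x - pq.1%:~R / pq.2%:~R| < 1 / (pq.2%:~R `^ z)]]].

(* Covers are indexed by an arbitrary set D of naturals, so that both finite and
   infinite covers are allowed; d j is the diameter of the j-th (open,
   nonempty) ball. *)
Definition hausdorff_content (R : realType) (s delta : R) (X : set R)
    : \bar R :=
  ereal_inf [set S : \bar R | exists (D : set nat) (c d : nat -> R),
    [/\ forall j, D j -> 0 < d j < delta,
        X `<=` \bigcup_(j in D) ball (c j) (d j / 2)
      & S = \esum_(j in D) (d j `^ s)%:E]].

Definition hausdorff_measure (R : realType) (s : R) (X : set R) : \bar R :=
  lim (hausdorff_content s delta X @[delta --> 0^'+]).

Definition hausdorff_dimension (R : realType) (X : set R) : \bar R :=
  ereal_inf [set s%:E | s in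
    [set s : R | 0 <= s /\ hausdorff_measure s X = 0%E]].

Definition closed_itv (R : realType) (I : R * R) : set R := `[I.1, I.2].

(* An interval [l, r] is represented by the pair (l, r). The value nchild 0 is
   irrelevant: nchild k.+1 is the number of level-k.+1 intervals contained in
   each level-k interval. *)
Record cantor_construction (R : realType) := CantorConstruction {
  level : nat -> {fset R * R} ;
  nchild : nat -> nat ;
  level0 : level 0%N = [fset (0, 1)]%fset ;
  level_nondegenerate : forall k (I : R * R), I \in level k -> I.1 < I.2 ;
  level_disjoint : forall k, trivIset [set` level k] (@closed_itv R) ;
  level_nested : forall k (J : R * R), J \in level k.+1 ->
    exists2 I : R * R, I \in level k & closed_itv J `<=` closed_itv I ;
  nchild_gt0 : forall k, (0 < nchild k.+1)%N ;
  level_nchild : forall k (I : R * R), I \in level k ->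
    #|` [fset J : R * R in level k.+1 | `[< (closed_itv J `<=` closed_itv I)%classic >]]%fset|
      = nchild k.+1 ;
  level_length : (\big[Order.max/0]_(J <- level k) (J.2 - J.1))
    @[k --> \oo] --> (0 : R)
}.

Definition cantor_set (R : realType) (C : cantor_construction R) : set R :=
  \bigcap_k \bigcup_(J in [set` level C k]) closed_itv J.

(* measurableTypeR R is R with its Borel sigma-algebra. *)
Definition is_uniform_measure (R : realType) (C : cantor_construction R)
    (mu : probability (measurableTypeR R) R) : Prop :=
  mu (~` cantor_set C) = 0%E /\
  forall k J, (0 < k)%N -> J \in level C k ->
    mu (closed_itv J) = ((\prod_(1 <= j < k.+1) nchild C j)%N%:R^-1)%:E.

(* Main.v *)
(* Starting from [0,1], intervals are refined in two ways. A plain step splits an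
   interval into m pieces separated by gaps. Fractions v/u whose denominator is
   small compared with the length of the interval are so sparse that they come
   close to at most one piece; dropping that piece keeps the set at distance
   about u^-2 from every v/u. A jump first shrinks the interval, of length l, to
   a subinterval of length about l^(a/2) around a fraction p/q with q about
   l^(-1/2), and then splits. Infinitely many jumps force the irrationality
   exponent to be at least a, and, as every step avoids the fractions it
   resolves, no point of the set is approximated to any order larger than a: the
   exponent is a on the whole set, not just almost everywhere.

   During a phase of plain steps about m^(ab/2) of the m pieces are kept, with m
   growing slowly from one phase to the next, so that an interval of length l
   ends up with measure l^(ab/2), hence, after a jump, with the power b of its
   length. Long phases make this exact in the limit; the mass distribution
   principle and the covers by the intervals following jumps give dimension b.
   The uniform measure is the image of Lebesgue measure on [0,1] under the map
   sending t to the point whose level-j interval has index floor (t N_j), where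
   N_j is the number of level-j intervals. *)
Require Import Defs.
From HB Require Import structures.
From mathcomp Require Import all_boot all_order all_algebra finmap.
From mathcomp Require Import all_classical all_reals all_analysis.
From mathcomp Require Import zify ring lra.

Set Implicit Arguments.
Unset Strict Implicit.
Unset Printing Implicit Defensive.

Import Order.TTheory GRing.Theory Num.Theory.
Import numFieldTopology.Exports numFieldNormedType.Exports.

Local Open Scope classical_set_scope.
Local Open Scope ring_scope.

(** * Fractions near an interval *)

Lemma distinct_fractions_apart (R : realFieldType) (p q u v : int) :
  0 < u -> 0 < v -> p%:~R / u%:~R != q%:~R / v%:~R :> R ->
  (u%:~R * v%:~R)^-1 <= `|p%:~R / u%:~R - q%:~R / v%:~R| :> R.
Proof.
move=> u0 v0 neq.
have ur : 0 < u%:~R :> R by rewrite ltr0z.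
have vr : 0 < v%:~R :> R by rewrite ltr0z.
have E : p%:~R / u%:~R - q%:~R / v%:~R =
    (p * v - q * u)%:~R / (u%:~R * v%:~R) :> R.
  by rewrite intrB !intrM; field; rewrite !gt_eqF.
have nz : p * v - q * u != 0.
  apply: contra neq => /eqP h.
  by rewrite -subr_eq0 E h mul0r.
rewrite E normrM (gtr0_norm (_ : 0 < (u%:~R * v%:~R)^-1)) ?invr_gt0 ?mulr_gt0//.
rewrite -[leLHS]mul1r ler_pM2r ?invr_gt0 ?mulr_gt0//.
by rewrite -intr_norm ler1z; lia.
Qed.

Lemma pigeonhole_ord (n : nat) (f : nat -> nat) :
  (forall i, (i <= n)%N -> (f i < n)%N) ->
  exists i j, [/\ (i < j)%N, (j <= n)%N & f i = f j].
Proof.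
move=> fn; case: n fn => [|n] fn; first by have := fn 0%N isT.
pose g (i : 'I_n.+2) : 'I_n.+1 := inord (f i).
have /injectivePn[x [y xy gxy]] : ~~ injectiveb g.
  apply/injectiveP => gi; have := leq_card g gi; by rewrite !card_ord ltnn.
have fxy : f x = f y.
  have := congr1 (@nat_of_ord _) gxy.
  by rewrite /g !inordK// fn// -ltnS.
have [xy'|yx|xy'] := ltngtP x y.
- by exists x, y; split => //; rewrite -ltnS.
- by exists y, x; split => //; rewrite -ltnS.
- by move/val_inj: xy' xy => ->; rewrite eqxx.
Qed.

(** Pigeonhole: two of the Q + 1 fractional parts of i y, i <= Q, fall into the same of the Q boxes
    of length 1 / Q; the difference of the two multiples of y gives p and q. *)
Lemma dirichlet_approximation (R : realType) (y : R) (Q : nat) : (0 < Q)%N ->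
  exists p q : int, [/\ 0 < q, q%:~R <= Q%:R :> R &
    `|y - p%:~R / q%:~R| < (q%:~R * Q%:R)^-1].
Proof.
move=> Q0.
have Qr : 0 < Q%:R :> R by rewrite ltr0n.
pose fr (i : nat) : R := i%:R * y - (Num.floor (i%:R * y))%:~R.
have fr0 i : 0 <= fr i < 1.
  have := floor_itv (i%:R * y); rewrite /fr intrD /= => /andP[a b]; lra.
pose f i := Num.truncn (Q%:R * fr i).
have fQ i : (i <= Q)%N -> (f i < Q)%N.
  move=> _; have /andP[a b] := fr0 i.
  rewrite /f truncn_lt_nat ?mulr_ge0// gtr_pMr//.
have [i [j [ij jQ fij]]] := pigeonhole_ord fQ.
exists (Num.floor (j%:R * y) - Num.floor (i%:R * y)), (j%:Z - i%:Z).
have d0 : 0 < (j%:Z - i%:Z)%:~R :> R by rewrite ltr0z; lia.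
split; first by lia.
  by rewrite -[leRHS]pmulrn; rewrite (_ : Q%:R = Q%:Z%:~R :> R)// ler_int; lia.
have ge0 k : 0 <= Q%:R * fr k by rewrite mulr_ge0//; case/andP: (fr0 k).
have /andP[a1 b1] := truncn_itv (ge0 i).
have /andP[a2 b2] := truncn_itv (ge0 j).
have lt : Q%:R * `|fr j - fr i| < 1.
  rewrite -[X in X * _]gtr0_norm// -normrM ltr_norml.
  move: a1 b1 a2 b2; rewrite -/(f i) -/(f j) -fij -natr1 => *.
  apply/andP; split; nra.
have -> : y - (Num.floor (j%:R * y) - Num.floor (i%:R * y))%:~R / (j%:Z - i%:Z)%:~R
   = (fr j - fr i) / (j%:Z - i%:Z)%:~R.
  apply: (mulIf (lt0r_neq0 d0)); rewrite mulrBl !divfK ?gt_eqF// /fr !intrB.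
  by rewrite -!pmulrn; ring.
rewrite normrM normfV (gtr0_norm d0) invfM mulrC.
rewrite ltr_pM2l ?invr_gt0// -(ltr_pM2l Qr) divff// ?gt_eqF//.
Qed.

(* Distinct fractions with denominators this small are further apart than the
   interval covered by the m pieces, and the gaps of length l between the pieces
   prevent a single fraction from being within l / 2 of two of them. *)
Lemma one_bad_piece (R : realType) (x l : R) (m : nat) : 0 < l ->
  exists i0 : nat, forall (p u : int) (i : nat) (y : R),
    0 < u -> 2 * u%:~R ^+ 2 * (2 * m%:R * l) < 1 ->
    (i < m)%N -> i != i0 -> x + 2 * l * i%:R <= y <= x + 2 * l * i%:R + l ->
    l / 2 <= `|y - p%:~R / u%:~R|.
Proof.
move=> l0.
pose bad (i : nat) := exists (p u : int) (y : R),
  [/\ 0 < u, 2 * u%:~R ^+ 2 * (2 * m%:R * l) < 1, (i < m)%N,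
   x + 2 * l * i%:R <= y <= x + 2 * l * i%:R + l & `|y - p%:~R / u%:~R| < l / 2].
have [[i0 [q [v [z [v0 vl im zi zq]]]]]|nobad] := pselect (exists i, bad i); last first.
  exists 0%N => p u i y u0 ul im _ yi; rewrite leNgt; apply/negP => h.
  by apply: nobad; exists i, p, u, y.
exists i0 => p u i y u0 ul im' ii yi; rewrite leNgt; apply/negP => h.
have ur : 0 < u%:~R :> R by rewrite ltr0z.
have vr : 0 < v%:~R :> R by rewrite ltr0z.
have far : l <= `|y - z|.
  move: ii; rewrite neq_ltn => /orP[] ij.
    have : (i%:R + 1 <= i0%:R :> R) by rewrite natr1 ler_nat.
    by move: yi zi => /andP[? ?] /andP[? ?] ?; rewrite distrC ler_normr; apply/orP; left; nra.
  have : (i0%:R + 1 <= i%:R :> R) by rewrite natr1 ler_nat.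
  by move: yi zi => /andP[? ?] /andP[? ?] ?; rewrite ler_normr; apply/orP; left; nra.
have near : `|y - z| <= (2 * m%:R - 1) * l.
  have : (i%:R + 1 <= m%:R :> R) by rewrite natr1 ler_nat.
  have : (i0%:R + 1 <= m%:R :> R) by rewrite natr1 ler_nat.
  have := ler0n R i; have := ler0n R i0.
  move: yi zi => /andP[? ?] /andP[? ?] ? ? ? ?; rewrite ler_norml; apply/andP; split; nra.
have [E|neq] := eqVneq (p%:~R / u%:~R : R) (q%:~R / v%:~R).
  have := ler_distD (q%:~R / v%:~R) y z.
  by rewrite [X in _ <= _ + X]distrC; move: h; rewrite E => *; lra.
have := distinct_fractions_apart u0 v0 neq.
have := ler_distD z (p%:~R / u%:~R : R) (q%:~R / v%:~R).
have := ler_distD y (p%:~R / u%:~R : R) z.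
rewrite [X in _ <= X + _ -> _]distrC => h1 h2 h3.
have : (u%:~R * v%:~R)^-1 < 2 * m%:R * l by lra.
set K := 2 * _ * l in ul vl * => lt.
have K0 : 0 < K by rewrite /K; have : `|y - z| >= 0 by []; lra.
have uv0 : 0 < u%:~R * v%:~R :> R by rewrite mulr_gt0.
move: lt; rewrite -(ltr_pM2r uv0) mulVf ?gt_eqF// => lt.
have := sqr_ge0 (u%:~R - v%:~R : R) => sq.
nra.
Qed.

Definition dyad (R : realType) (n : nat) : R := (2 ^+ n)^-1.

Lemma dyad_gt0 (R : realType) n : 0 < dyad R n.
Proof. by rewrite invr_gt0 exprn_gt0. Qed.

Lemma dyadD (R : realType) m n : dyad R (m + n) = dyad R m * dyad R n.
Proof. by rewrite /dyad exprD invfM. Qed.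

Lemma dyad0 (R : realType) : dyad R 0 = 1.
Proof. by rewrite /dyad expr0 invr1. Qed.

Lemma dyadS (R : realType) n : dyad R n.+1 = dyad R n / 2.
Proof. by rewrite /dyad exprSr invfM. Qed.

Lemma ler_dyad (R : realType) m n : (dyad R m <= dyad R n) = (n <= m)%N.
Proof. by rewrite lef_pV2 ?posrE ?exprn_gt0// ler_eXn2l// ltr1n. Qed.

Lemma ltr_dyad (R : realType) m n : (dyad R m < dyad R n) = (n < m)%N.
Proof. by rewrite ltNge ler_dyad -ltnNge. Qed.

(** * Lengths and numbers of the intervals *)

(* The level described by a state has 2 ^ mass intervals of length 2 ^- depth.
   Phase k splits every interval into 2 ^ (k + 1) pieces, and start is the depth
   right after the jump that opened the phase. *)
Record state := State { phase : nat; start : nat; depth : nat; mass : nat }.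

Section automaton.
Variables (R : realType) (a b : R).

(** The 2 ^ (phase + 1) pieces alternate with gaps of their own length, hence one more factor 2 in
    the length. *)
Definition split_exp (w : state) : nat := phase w + 2.

(* The exponent a * b / 2 turns into b when a jump multiplies the depth by a / 2. *)
Definition child_exp (w : state) : nat := Num.truncn (a * b / 2 * (phase w)%:R).

(* The threshold makes the depth reached before the phase and the additive errors
   made in it negligible with respect to the current depth. *)
Definition jump (w : state) : bool :=
  ((phase w + 2) * (start w + phase w + 2) <= depth w)%N.

(** With Q = 2 ^ denom_exp, l the length of the interval and g = 2 ^ split_exp, this makes Q ^ 2 l
    at least 8 g ^ 2, the margin with which Dirichlet's theorem is applied at a jump. *)
Definition denom_exp (w : state) : nat := ((depth w + 4)./2 + split_exp w)%N.

(* After a jump the base has length < q ^- a for every q <= 2 ^ denom_exp; the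
   summand 2 gives moreover 2 q ^ 2 2 ^- base_exp < 1, so that the following split
   also moves away from the fraction the jump was aimed at. *)
Definition base_exp (w : state) : nat :=
  if jump w then (Num.truncn (a * (denom_exp w)%:R) + 2)%N else depth w.

Definition next (w : state) : state :=
  let d := (base_exp w + split_exp w)%N in
  let m := (mass w + child_exp w)%N in
  if jump w then State (phase w).+1 d d m else State (phase w) (start w) d m.

Definition st (j : nat) : state := iter j next (State 0 0 0 0).

Lemma stS j : st j.+1 = next (st j).
Proof. by []. Qed.

Lemma depthS j : depth (st j.+1) = (base_exp (st j) + split_exp (st j))%N.
Proof. by rewrite stS /next; case: ifP. Qed.

Lemma massS j : mass (st j.+1) = (mass (st j) + child_exp (st j))%N.
Proof. by rewrite stS /next; case: ifP. Qed.

Lemma phaseS j : phase (st j.+1) = (phase (st j) + jump (st j))%N.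
Proof. by rewrite stS /next; case: ifP => _ /=; rewrite ?addn1 ?addn0. Qed.

Lemma leq_phase i j : (i <= j)%N -> (phase (st i) <= phase (st j))%N.
Proof.
elim: j => [|j IH]; first by case: i.
rewrite leq_eqVlt => /orP[/eqP->//|]; rewrite ltnS => /IH h.
by rewrite phaseS; lia.
Qed.

Hypotheses (ha : 2 <= a) (hb : 0 <= b <= 2 / a).

Let params : [/\ 0 < a, 2 <= a, 0 <= b, a * b <= 2 & b <= a * b / 2 <= 1].
Proof.
case/andP: hb => B0; have A2 := ha; have A0 : 0 < a by lra.
rewrite ler_pdivlMr// mulrC => AB; split => //; apply/andP; split; nra.
Qed.

Lemma base_exp_jump w : jump w ->
  [/\ a * (denom_exp w)%:R < (base_exp w)%:R,
      (2 * denom_exp w + 2 <= base_exp w)%N & (depth w + 6 <= base_exp w)%N].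
Proof.
have [A0 A2 B0 AB /andP[BB BE]] := params.
move=> jw; rewrite /base_exp jw.
have r0 : 0 <= a * (denom_exp w)%:R by rewrite mulr_ge0// ltW.
have h : a * (denom_exp w)%:R < (Num.truncn (a * (denom_exp w)%:R)).+1%:R.
  by rewrite truncnS_gt.
have h2 : (2 * denom_exp w <= Num.truncn (a * (denom_exp w)%:R))%N.
  by rewrite truncn_ge_nat// natrM ler_wpM2r.
split.
- by apply: (lt_le_trans h); rewrite ler_nat addn2.
- by rewrite leq_add2r.
- by move: h2; rewrite /denom_exp /split_exp; clear; lia.
Qed.

Lemma depth_le_base w : (depth w <= base_exp w)%N.
Proof.
rewrite /base_exp; case: ifPn => // jw; have [_ _] := base_exp_jump jw.
by rewrite /base_exp jw; lia.
Qed.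

(** Since a * b / 2 <= 1, at most half of the 2 ^ (phase + 1) pieces are kept, which leaves room for
    dropping the bad one. *)
Lemma child_exp_le w : (child_exp w + 2 <= split_exp w)%N.
Proof.
have [A0 A2 B0 AB /andP[BB BE]] := params.
rewrite leq_add2r /child_exp truncn_le_nat.
apply: (@le_lt_trans _ _ (phase w)%:R); last by rewrite ltr_nat.
by rewrite ler_piMl.
Qed.

Lemma child_exp_ge w : a * b / 2 * (phase w)%:R - 1 <= (child_exp w)%:R.
Proof.
rewrite lerBlDr natr1; apply/ltW; exact: truncnS_gt.
Qed.

Lemma base_exp_lt_depthS j : (base_exp (st j) < depth (st j.+1))%N.
Proof. rewrite depthS /split_exp; lia. Qed.

Lemma leq_base i j : (i <= j)%N -> (base_exp (st i) <= base_exp (st j))%N.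
Proof.
elim: j => [|j IH]; first by case: i.
rewrite leq_eqVlt => /orP[/eqP->//|]; rewrite ltnS => /IH h.
by have := base_exp_lt_depthS j; have := depth_le_base (st j.+1); lia.
Qed.

Lemma base_exp_geid j : (j <= base_exp (st j))%N.
Proof.
elim: j => // j; have := base_exp_lt_depthS j; have := depth_le_base (st j.+1); lia.
Qed.

Lemma ltn_depth i j : (i < j)%N -> (depth (st i) < depth (st j))%N.
Proof.
elim: j => // j IH; rewrite ltnS leq_eqVlt => /orP[/eqP->|/IH].
all: have := base_exp_lt_depthS j; have := depth_le_base (st j); lia.
Qed.

Lemma depth_geid j : (j <= depth (st j))%N.
Proof. by elim: j => // j IH; apply: leq_ltn_trans (ltn_depth (ltnSn j)). Qed.

Lemma startS j :
  start (st j.+1) = if jump (st j) then depth (st j.+1) else start (st j).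
Proof. by rewrite depthS stS /next; case: ifP. Qed.

Lemma start_le_depth j : (start (st j) <= depth (st j))%N.
Proof.
elim: j => // j IH; rewrite startS; case: ifP => // _.
exact: leq_trans IH (ltnW (ltn_depth (ltnSn j))).
Qed.

(** At a jump, this splits the earlier steps into those completed at depth at most [start],
    negligible against the current depth, and plain ones, which change the depth only by
    [split_exp]. *)
Lemma start_or_plain i j : (i < j)%N ->
  (depth (st i.+1) <= start (st j))%N \/ base_exp (st i) = depth (st i).
Proof.
elim: j => // j IH; rewrite ltnS leq_eqVlt startS => /orP[/eqP->|/IH h].
  case: ifPn => jw; last by right; rewrite /base_exp (negbTE jw).
  by left.
case: ifPn => // jw; case: h => [h|]; [left|by right].
apply: leq_trans h (leq_trans (start_le_depth j) _).
exact: ltnW (ltn_depth (ltnSn j)).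
Qed.

(** The phase grows only at a jump, whose threshold is quadratic in it. Errors linear in the phase
    are thus negligible against the depth. *)
Lemma phase_sq_depth j : (phase (st j) ^ 2 <= depth (st j))%N.
Proof.
elim: j => // j IH; rewrite phaseS.
have := base_exp_lt_depthS j; have := depth_le_base (st j); move: IH.
case: (boolP (jump (st j))) => [|_]; rewrite /jump; nia.
Qed.

(** T counts the splits since the current phase opened. The mass collected before is thrown away. *)
Lemma phase_steps j : exists T, [/\
  depth (st j) = (start (st j) + T * split_exp (st j))%N &
  (T * child_exp (st j) <= mass (st j))%N].
Proof.
elim: j => [|j [T [dT mT]]]; first by exists 0%N.
rewrite stS /next; case: ifPn => jw; first by exists 0%N; rewrite /= addn0.
exists T.+1 => /=; rewrite /base_exp (negbTE jw) /split_exp/= dT /split_exp/=.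
by split; [lia|rewrite mulSnr leq_add2r].
Qed.

Lemma mass_le_depth j : (mass (st j))%:R <= a * b / 2 * (depth (st j))%:R.
Proof.
have [A0 A2 B0 AB /andP[BB BE]] := params.
elim: j => [|j IH]; first by rewrite mulr0.
have le : (depth (st j) + phase (st j) <= depth (st j.+1))%N.
  by rewrite depthS /split_exp; have := depth_le_base (st j); lia.
have ab0 : 0 <= a * b / 2 by nra.
apply: (@le_trans _ _ (a * b / 2 * (depth (st j) + phase (st j))%:R)); last first.
  by rewrite ler_wpM2l// ler_nat.
rewrite massS !natrD mulrDr lerD// /child_exp truncn_le mulr_ge0//.
Qed.

(** Without further jumps the threshold would stay fixed while the depth keeps growing. *)
Lemma jump_unbounded j : exists2 i, (j <= i)%N & jump (st i).
Proof.
apply: contrapT => nj.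
have plain i : (j <= i)%N -> ~~ jump (st i).
  by move=> ji; apply/negP => h; apply: nj; exists i.
have const i : phase (st (j + i)) = phase (st j) /\ start (st (j + i)) = start (st j).
  elim: i => [|i [IH1 IH2]]; first by rewrite addn0.
  by rewrite addnS stS /next (negbTE (plain _ _)) ?leq_addr.
pose c := ((phase (st j) + 2) * (start (st j) + phase (st j) + 2))%N.
have [c1 c2] := const c; have := plain (j + c)%N (leq_addr _ _).
rewrite /jump c1 c2 -/c => /negP; apply.
by apply: leq_trans (depth_geid _); lia.
Qed.

Lemma phase_unbounded k : exists j0, forall j, (j0 <= j)%N -> (k <= phase (st j))%N.
Proof.
elim: k => [|k [j0 H]]; first by exists 0%N.
have [i ji jw] := jump_unbounded j0.
exists i.+1 => j ij; apply: leq_trans (leq_phase ij).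
by rewrite phaseS jw addn1 ltnS; apply: H.
Qed.

Lemma jump_phase_unbounded k : exists2 j, jump (st j) & (k <= phase (st j))%N.
Proof.
have [j0 H] := phase_unbounded k; have [j jj0 jw] := jump_unbounded j0.
by exists j => //; apply: H.
Qed.

Lemma base_exp_upper w :
  (base_exp w)%:R <= a / 2 * (depth w)%:R + a * ((phase w)%:R + 4) + 2 :> R.
Proof.
have [A0 A2 B0 AB /andP[BB BE]] := params.
have X0 := ler0n R (depth w); have k0 := ler0n R (phase w).
rewrite /base_exp; case: ifPn => jw; last by nra.
have r0 : 0 <= a * (denom_exp w)%:R by rewrite mulr_ge0// ltW.
rewrite natrD lerD2r; apply: (@le_trans _ _ (a * (denom_exp w)%:R)).
  by rewrite truncn_le.
have : (2 * denom_exp w <= depth w + 2 * (phase w + 4))%N.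
  rewrite /denom_exp /split_exp; clear; lia.
rewrite -(ler_nat R) !(natrM, natrD) => h; nra.
Qed.

(** Used for the upper bound on the exponent: a fraction resolved at step i + 1 but not at step i
    has a squared denominator of order at least 2 ^ base_exp (st i), and its distance to the set is
    at least half the length at level i + 2. Between these two depths there is at most one jump,
    hence one factor a / 2. *)
Lemma base_exp_growth (d : R) : 0 < d -> exists j0, forall i, (j0 <= i)%N ->
  (depth (st i.+2))%:R + 1 <= (a / 2 + d) * (base_exp (st i))%:R.
Proof.
have [A0 A2 B0 AB /andP[BB BE]] := params.
move=> d0.
(* For a phase k >= 5 the additive errors sum to at most 8 a k; with 8 a <= d k this is at most d k
   ^ 2, hence at most d times [base_exp]. *)
have [j0 H] := phase_unbounded (Num.truncn (8 * a / d) + 5).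
exists j0 => i /H {}H.
have kd : 8 * a <= d * (phase (st i))%:R.
  rewrite -ler_pdivrMl// mulrC; apply/ltW/(lt_le_trans (truncnS_gt _)).
  by rewrite ler_nat; apply: leq_trans H; rewrite addnS ltnS leq_addr.
have k5 : 5 <= (phase (st i))%:R :> R by rewrite ler_nat; apply: leq_trans H; rewrite leq_addl.
have sq : (phase (st i))%:R ^+ 2 <= (base_exp (st i))%:R :> R.
  by rewrite -natrX ler_nat (leq_trans (phase_sq_depth _)) ?depth_le_base.
have up := base_exp_upper (st i.+1); rewrite depthS natrD /split_exp natrD in up.
have ph : (phase (st i.+1))%:R <= (phase (st i))%:R + 1 :> R.
  by rewrite natr1 ler_nat phaseS -addn1 leq_add2l; case: (jump _).
rewrite depthS natrD /split_exp natrD.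
set K := (phase (st i))%:R in kd k5 sq up ph *; set Z := (base_exp (st i))%:R in sq up *.
move: (phase _)%:R (base_exp _)%:R up ph => K' Z' h1 h2.
have h3 : 8 * a * K <= d * Z.
  apply: (@le_trans _ _ (d * K ^+ 2)); last by rewrite ler_wpM2l// ltW.
  by rewrite expr2 mulrA ler_wpM2r//; lra.
have h4 : a * K' <= a * (K + 1) by rewrite ler_pM2l.
have h5 : a * 5 <= a * K by rewrite ler_pM2l.
have h6 : 2 * K <= a * K by rewrite ler_wpM2r//; lra.
lra.
Qed.

(** In a phase the mass grows by about a b / 2 per unit of depth, and the jump multiplies the depth
    by about a / 2, so their ratio afterwards is about b > s. The summand s (phase + 3) is s times
    the [split_exp] of the next phase, kept in reserve for [mass_lower]. *)
Lemma jump_mass_lower (s : R) j : 0 <= s < b -> jump (st j) ->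
  12 <= (b - s) * ((phase (st j))%:R + 2) ->
  s * (depth (st j.+1))%:R + s * ((phase (st j))%:R + 3) <= (mass (st j))%:R.
Proof.
have [A0 A2 B0 AB /andP[BB BE]] := params.
move=> /andP[s0 sb] jw large.
have [T [dT mT]] := phase_steps j.
have up := base_exp_upper (st j).
have g := child_exp_ge (st j).
move: jw; rewrite /jump -(ler_nat R) natrM !natrD => jw.
move/(congr1 (fun n => n%:R : R)): dT; rewrite natrD natrM /split_exp natrD => dT.
move: mT; rewrite -(ler_nat R) natrM => mT.
rewrite depthS natrD /split_exp natrD.
have := ler0n R (start (st j)); have := ler0n R T; have := ler0n R (phase (st j)).
move: (phase _)%:R (start _)%:R (mass _)%:R (depth _)%:R (child_exp _)%:R
  (base_exp _)%:R T%:R large jw dT mT up g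
  => k S Y X G Z t large jw dT mT up g k0 t0 S0.
have ab0 : 0 <= a * b by nra.
(* Each of the t splits loses at most 3: 1 by truncation in [child_exp], and a b <= 2 because the
   depth grows by k + 2 and not by k. *)
have Y1 : a * b / 2 * (X - S) - 3 * t <= Y.
  have : t * (a * b / 2 * k - 1) <= t * G by rewrite ler_wpM2l.
  have : a * b / 2 * (2 * t) <= 2 * t by nra.
  rewrite dT; nra.
have X0 : 0 <= X by nra.
have Xk : (k + 2) ^+ 2 <= X by nra.
have XS : (k + 2) * S <= X by nra.
have Xt : (k + 2) * t <= X by nra.
have k2 : 0 < k + 2 by lra.
have Z1 : s * (Z + (k + 2)) + s * (k + 3) <=
    s * (a / 2) * X + s * (a + 2) * (k + 4).
  have : s * Z <= s * (a / 2 * X + a * (k + 4) + 2) by rewrite ler_wpM2l.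
  nra.
suff : s * (a / 2) * X + s * (a + 2) * (k + 4) <= a * b / 2 * (X - S) - 3 * t.
  lra.
(* After multiplication by k + 2 the jump threshold bounds every error by a multiple of X. They add
   up to 2 a X + 8 X <= 6 a X, which the gain [e3] covers; this fixes the constant 12. *)
rewrite -(ler_pM2l k2).
have e1 : (k + 2) * (s * (a + 2) * (k + 4)) <= 2 * (a + 2) * X.
  have h1 : (k + 2) * (k + 4) <= 2 * X by nra.
  have h2 : s * (a + 2) <= a + 2 by nra.
  have h3 : 0 <= s * (a + 2) by nra.
  have -> : (k + 2) * (s * (a + 2) * (k + 4)) = s * (a + 2) * ((k + 2) * (k + 4)) by ring.
  nra.
have e2 : (k + 2) * (a * b / 2 * S) <= X.
  have -> : (k + 2) * (a * b / 2 * S) = a * b / 2 * ((k + 2) * S) by ring.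
  have : 0 <= (k + 2) * S by nra.
  nra.
have e3 : 6 * a * X <= (k + 2) * (a / 2 * (b - s)) * X.
  apply: ler_wpM2r => //; nra.
have e4 : 2 * X <= a * X by rewrite ler_wpM2r.
lra.
Qed.

(** The mass of level j is compared with the depth of level j + 1 because a ball of intermediate
    size is bounded in measure by level j and in diameter by level j + 1. *)
Lemma mass_lower (s : R) : 0 <= s < b -> exists j0, forall j, (j0 <= j)%N ->
  s * (depth (st j.+1))%:R <= (mass (st j))%:R.
Proof.
have [A0 A2 B0 AB /andP[BB BE]] := params.
move=> sb; have /andP[s0 sb'] := sb.
have bs : 0 < b - s by lra.
have [i ji ki] := jump_phase_unbounded (Num.truncn (12 / (b - s))).+1.
have large j : (i <= j)%N -> 12 <= (b - s) * ((phase (st j))%:R + 2).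
  move=> /leq_phase h; rewrite -ler_pdivrMl// mulrC.
  apply/ltW/(lt_le_trans (truncnS_gt _)).
  by rewrite -natrD ler_nat (leq_trans ki)// (leq_trans h)// leq_addr.
(* The reserve s (phase + 2) pays for the next split if that step is plain. A jump renews it, and a
   plain step preserves it as [child_exp] is at least s times [split_exp]. *)
have inv j : (i < j)%N ->
    s * (depth (st j))%:R + s * ((phase (st j))%:R + 2) <= (mass (st j))%:R.
  elim: j => // j IH; rewrite ltnS => ij.
  have ml := jump_mass_lower sb _ (large j ij).
  case: (boolP (jump (st j))) => jw.
    rewrite phaseS jw addn1 -natr1 massS natrD.
    have := ml jw; have := ler0n R (child_exp (st j)); nra.
  have {}ij : (i < j)%N.
    rewrite ltn_neqAle ij andbT; apply: contraNneq jw => <-; exact: ji.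
  rewrite phaseS (negbTE jw) addn0 massS depthS /base_exp (negbTE jw) /split_exp !natrD.
  have := IH ij; have := child_exp_ge (st j); have := large j (ltnW ij).
  have := ler0n R (phase (st j)); nra.
exists i.+1 => j ij.
case: (boolP (jump (st j))) => jw.
  have := jump_mass_lower sb jw (large j (ltnW ij)).
  have := ler0n R (phase (st j)); nra.
have := inv j ij.
rewrite depthS /base_exp (negbTE jw) /split_exp !natrD; nra.
Qed.

(** The level right after a jump with large phase k serves: the jump turns the rate a b / 2 into b,
    the split adds at most k to the mass, and (s - b) (k + 2) ^ 2 exceeds k + M. *)
Lemma mass_upper (s M : R) : b < s -> exists j, (mass (st j))%:R + M <= s * (depth (st j))%:R.
Proof.
have [A0 A2 B0 AB /andP[BB BE]] := params.
move=> bs; have sb : 0 < s - b by lra.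
have [j jw kj] := jump_phase_unbounded (Num.truncn ((1 + `|M|) / (s - b))).+1.
exists j.+1.
have large : 1 + `|M| <= (s - b) * ((phase (st j))%:R + 2).
  rewrite -ler_pdivrMl// mulrC.
  apply/ltW/(lt_le_trans (truncnS_gt _)).
  by rewrite -natrD ler_nat (leq_trans kj)// leq_addr.
have [bz _ _] := base_exp_jump jw.
have dz : (depth (st j))%:R / 2 <= (denom_exp (st j))%:R :> R.
  by rewrite ler_pdivrMr// -natrM ler_nat /denom_exp; clear; lia.
have ml := mass_le_depth j.
have G1 : (child_exp (st j))%:R <= (phase (st j))%:R :> R.
  rewrite ler_nat; have := child_exp_le (st j).
  by rewrite /split_exp leq_add2r.
have sq : ((phase (st j))%:R + 2) ^+ 2 <= (depth (st j.+1))%:R :> R.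
  rewrite -natrD -natrX ler_nat.
  apply: leq_trans (leq_trans _ jw) (ltnW (ltn_depth (ltnSn j))).
  by rewrite -mulnn leq_mul// leq_add2r leq_addl.
have bX : a * b / 2 * (depth (st j))%:R <= b * (depth (st j.+1))%:R.
  rewrite depthS natrD.
  have : a * ((depth (st j))%:R / 2) <= a * (denom_exp (st j))%:R by rewrite ler_pM2l.
  have := ler0n R (split_exp (st j)); nra.
rewrite massS natrD.
have M1 := ler_norm M; have M0 := normr_ge0 M.
have k0 := ler0n R (phase (st j)).
have : (s - b) * ((phase (st j))%:R + 2) ^+ 2 <= (s - b) * (depth (st j.+1))%:R.
  by rewrite ler_wpM2l// ltW.
nra.
Qed.

End automaton.

(** * The tree of intervals *)

Lemma exists_dyad_lt (R : realType) (c : R) : exists n, c * dyad R n < 1.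
Proof.
exists (Num.truncn c).+1; rewrite ltr_pdivrMr ?exprn_gt0// mul1r.
apply: lt_trans (truncnS_gt _) _.
by rewrite -natrX ltr_nat ltn_expl.
Qed.

Section tree.
Variables (R : realType) (a b : R).

Local Notation st := (st a b).
Local Notation base_exp := (base_exp a).
Local Notation child_exp := (child_exp a b).
Local Notation dyad := (dyad R).

Definition rational_base (w : state) (x : R) : set R := [set x' |
  x <= x' /\ x' + dyad (base_exp w) <= x + dyad (depth w) /\
  exists p q : int, [/\ 0 < q, q%:~R <= 2 ^+ denom_exp w :> R &
    forall y, x' <= y <= x' + dyad (base_exp w) ->
      `|y - p%:~R / q%:~R| <= dyad (base_exp w)]].

(** The default x lies in the interval anyway, so nesting holds without knowing that a jump finds a
    fraction. *)
Definition base (w : state) (x : R) : R :=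
  if jump w then xget x (rational_base w x) else x.

Definition next_length (w : state) : R := dyad (base_exp w + split_exp w).

Definition bad_piece (w : state) (x : R) : nat := xget 0%N [set i0 : nat |
  forall (p u : int) (i : nat) (y : R),
    0 < u -> 2 * u%:~R ^+ 2 * dyad (base_exp w) < 1 ->
    (i < 2 ^ (split_exp w).-1)%N -> i != i0 ->
    base w x + 2 * next_length w * i%:R <= y
      <= base w x + 2 * next_length w * i%:R + next_length w ->
    next_length w / 2 <= `|y - p%:~R / u%:~R|].

(** [bump] numbers the pieces while skipping the bad one. *)
Definition child (w : state) (x : R) (i : nat) : R :=
  base w x + 2 * next_length w * (bump (bad_piece w x) i)%:R.

(** The quotient of t by the number of children is the index of the parent, the remainder the rank
    among siblings. *)
Fixpoint left_end (j t : nat) : R :=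
  if j is k.+1 then
    let n := (2 ^ child_exp (st k))%N in
    child (st k) (left_end k (t %/ n)) (t %% n)
  else 0.

Lemma next_length_gt0 w : 0 < next_length w.
Proof. exact: dyad_gt0. Qed.

Lemma pieces_length w :
  2 * (2 ^ (split_exp w).-1)%N%:R * next_length w = dyad (base_exp w).
Proof.
rewrite /next_length dyadD /split_exp addn2 /= natrX -exprS mulrCA.
by rewrite /dyad divff ?mulr1// gt_eqF// exprn_gt0.
Qed.

Lemma bad_pieceP w x (p u : int) (i : nat) (y : R) :
    0 < u -> 2 * u%:~R ^+ 2 * dyad (base_exp w) < 1 ->
    (i < 2 ^ (split_exp w).-1)%N -> i != bad_piece w x ->
    base w x + 2 * next_length w * i%:R <= y
      <= base w x + 2 * next_length w * i%:R + next_length w ->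
    next_length w / 2 <= `|y - p%:~R / u%:~R|.
Proof.
have [i0 H] := one_bad_piece (base w x) (2 ^ (split_exp w).-1) (next_length_gt0 w).
rewrite /bad_piece; case: xgetP => [_ -> |/(_ i0) []]; first exact.
by move=> p' u' i' y'; rewrite -pieces_length; apply: H.
Qed.

Hypotheses (ha : 2 <= a) (hb : 0 <= b <= 2 / a).

Lemma base_subinterval w x :
  x <= base w x /\ base w x + dyad (base_exp w) <= x + dyad (depth w).
Proof.
have le : x <= x /\ x + dyad (base_exp w) <= x + dyad (depth w).
  by split => //; rewrite lerD2l ler_dyad (depth_le_base ha hb).
by rewrite /base; case: ifP => // _; case: xgetP => // _ -> [? []].
Qed.

Lemma bump_bad_piece w x i : (i < 2 ^ child_exp w)%N ->
  (bump (bad_piece w x) i < 2 ^ (split_exp w).-1)%N.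
Proof.
move=> ig; have : (2 ^ (child_exp w).+1 <= 2 ^ (split_exp w).-1)%N.
  by rewrite leq_exp2l//; have := child_exp_le ha hb w; clear; lia.
have := expn_gt0 2 (child_exp w).
by rewrite expnS /bump; move: ig; clear; case: leqP => /=; lia.
Qed.

Lemma child_subinterval w x i : (i < 2 ^ child_exp w)%N ->
  base w x <= child w x i /\
  child w x i + next_length w <= base w x + dyad (base_exp w).
Proof.
move=> /(bump_bad_piece x); have l0 := next_length_gt0 w.
rewrite /child -pieces_length -(ltr_nat R) => lt.
split; first by rewrite lerDl !mulr_ge0// ltW.
have : (bump (bad_piece w x) i)%:R + 1 <= (2 ^ (split_exp w).-1)%N%:R :> R.
  by rewrite natr1 ler_nat -(ltr_nat R).
move: (bump _ _)%:R (2 ^ _)%:R => u v uv; nra.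
Qed.

Lemma left_end_nested j t :
  left_end j (t %/ 2 ^ child_exp (st j)) <= left_end j.+1 t /\
  left_end j.+1 t + dyad (depth (st j.+1)) <=
    left_end j (t %/ 2 ^ child_exp (st j)) + dyad (depth (st j)).
Proof.
rewrite [left_end j.+1 t]/= depthS.
set x := left_end j _; have [bx1 bx2] := base_subinterval (st j) x.
have [] := @child_subinterval (st j) x (t %% 2 ^ child_exp (st j)).
  by rewrite ltn_pmod// expn_gt0.
rewrite /next_length => h1 h2; split; [exact: le_trans h1|exact: le_trans bx2].
Qed.

Definition avoids (j : nat) (x : R) := forall i (p u : int) (y : R),
  (i < j)%N -> 0 < u -> 2 * u%:~R ^+ 2 * dyad (base_exp (st i)) < 1 ->
  x <= y <= x + dyad (depth (st j)) ->
  dyad (depth (st i.+1)) / 2 <= `|y - p%:~R / u%:~R|.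

Lemma left_end_avoids j t : avoids j (left_end j t).
Proof.
elim: j t => // j IH t i p u y ij u0 ui yt.
have [n1 n2] := left_end_nested j t.
move: ij; rewrite ltnS leq_eqVlt => /orP[/eqP ij|ij]; last first.
  apply: (IH (t %/ 2 ^ child_exp (st j))%N) => //; move: yt => /andP[? ?]; lra.
rewrite ij in ui *; rewrite depthS.
have lt : (t %% 2 ^ child_exp (st j) < 2 ^ child_exp (st j))%N.
  by rewrite ltn_pmod// expn_gt0.
set x := left_end j (t %/ 2 ^ child_exp (st j)).
apply: (@bad_pieceP (st j) x p u (bump (bad_piece (st j) x) (t %% 2 ^ child_exp (st j)))) => //.
- exact: bump_bad_piece.
- by rewrite eq_sym neq_bump.
- by move: yt; rewrite depthS.
Qed.

Lemma first_resolved (u : int) : 0 < u -> exists i,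
  2 * u%:~R ^+ 2 * dyad (base_exp (st i.+1)) < 1 /\
  1 <= 2 * u%:~R ^+ 2 * dyad (base_exp (st i)).
Proof.
move=> u0; have u1 : 1 <= u%:~R :> R by rewrite ler1z.
have ex : exists i, 2 * u%:~R ^+ 2 * dyad (base_exp (st i)) < 1.
  have [n nlt] := exists_dyad_lt (2 * u%:~R ^+ 2 : R).
  exists n; apply: le_lt_trans nlt; apply: ler_wpM2l; first by rewrite mulr_ge0 ?sqr_ge0.
  by rewrite ler_dyad (base_exp_geid ha hb).
case: (ex_minnP ex) => -[|i] lti mini.
  (* Step 0 is plain and has base [0, 1], so it resolves no denominator. *)
  have : dyad (base_exp (st 0)) = 1 by rewrite /base_exp /jump/= dyad0.
  by move: lti => /[swap] ->; nra.
exists i; split => //; rewrite leNgt; apply/negP => /mini; by rewrite ltnn.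
Qed.

(* Dirichlet's theorem gives p / q close to the midpoint with q <= 2 ^ denom_exp.
   It lies in the interval unless q is much smaller than 2 ^ denom_exp, and such
   fractions have been avoided at the level i that resolves their denominator. *)
Lemma rational_base_nonempty j x : jump (st j) -> avoids j x ->
  rational_base (st j) x !=set0.
Proof.
move=> jw av.
have jw2 : (0 < j)%N by case: (j) jw.
have r1 : (start (st j) + 1 <= denom_exp (st j))%N.
  by move: jw; rewrite /jump /denom_exp /split_exp; clear; nia.
have r2 : (depth (st j) + (2 * split_exp (st j) + 3) <= denom_exp (st j) + denom_exp (st j))%N.
  by rewrite /denom_exp; clear; lia.
have [_ _ zx] := base_exp_jump ha hb jw.
set lam := dyad (depth (st j)); set kap := dyad (base_exp (st j)).
have lam0 : 0 < lam by exact: dyad_gt0.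
have kap0 : 0 < kap by exact: dyad_gt0.
have kl : kap <= lam / 2 by rewrite -dyadS ler_dyad; move: zx; clear; lia.
set y := x + lam / 2.
have yx : x <= y <= x + lam by rewrite /y; apply/andP; split; lra.
have Q0 : (0 < 2 ^ denom_exp (st j))%N by rewrite expn_gt0.
have [p [q [q0 qQ pq]]] := dirichlet_approximation y Q0.
rewrite natrX in qQ pq; set Q := 2 ^+ _ in qQ pq.
have Q1 : 0 < Q by rewrite exprn_gt0.
have q1 : 1 <= q%:~R :> R by rewrite ler1z.
set g : R := 2 ^+ split_exp (st j).
have g1 : 1 <= g by rewrite exprn_ege1// ler1n.
have Qlam : 8 * g ^+ 2 <= Q ^+ 2 * lam.
  rewrite /lam /dyad ler_pdivlMr ?exprn_gt0// (_ : 8 = 2 ^+ 3 :> R); last by rewrite -natrX.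
  rewrite -!exprM -!exprD ler_eXn2l ?ltr1n//.
  by move: r2; clear; lia.
have d0 : 0 <= `|y - p%:~R / q%:~R| by [].
have dqQ : `|y - p%:~R / q%:~R| * (q%:~R * Q) < 1.
  by rewrite -ltr_pdivlMr ?mulr_gt0 ?div1r//; lra.
have close : `|y - p%:~R / q%:~R| <= lam / 2.
  have [i [qi1 qi0]] := first_resolved q0.
  have hj k : (k <= j)%N -> (split_exp (st k) <= split_exp (st j))%N.
    by move=> kj; rewrite /split_exp leq_add2r leq_phase.
  move: (q%:~R : R) (`|_|) q1 dqQ d0 qi0
    (fun ij => av i.+1 p q y ij q0 qi1 yx) => {pq qQ qi1}.
  move=> u d u1 duQ d0 ui avi.
  have u0 : 0 < u by apply: lt_le_trans u1.
  have uQ0 : 0 < u * Q by rewrite mulr_gt0.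
  (* A denominator not resolved before step j satisfies 2 u ^ 2 lam g >= 1. Then u Q lam >= 2, and
     Dirichlet's bound d < 1 / (u Q) suffices. *)
  have [ij|ij] := ltnP i.+1 j; last first.
    have kl2 : dyad (base_exp (st i)) <= lam * g.
      rewrite -ler_pdivrMr; last exact: lt_le_trans g1.
      rewrite -[g^-1]/(dyad _) -dyadD ler_dyad.
      move: jw2 ij hj; case: (j) => // k _ ki /(_ k (leqnSn k)) hk.
      by rewrite depthS leq_add// leq_base.
    have u2 : 1 <= 2 * u ^+ 2 * (lam * g).
      by apply: le_trans ui _; rewrite ler_wpM2l// mulr_ge0// sqr_ge0.
    have big : 2 <= u * Q * lam.
      have uQl0 : 0 <= u * Q * lam by rewrite mulr_ge0//; apply/ltW.
      rewrite -(@ler_pXn2r _ 2) ?nnegrE//.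
      have : u ^+ 2 * lam * (8 * g ^+ 2) <= u ^+ 2 * lam * (Q ^+ 2 * lam).
        by rewrite ler_wpM2l// mulr_ge0 ?sqr_ge0// ltW.
      have : 4 * g * 1 <= 4 * g * (2 * u ^+ 2 * (lam * g)).
        by rewrite ler_wpM2l// mulr_ge0//; lra.
      lra.
    have : d * 2 <= d * (u * Q * lam) by exact: ler_wpM2l.
    have : d * (u * Q) * lam <= 1 * lam by rewrite ler_wpM2r// ltW.
    lra.
  (* If the resolving step ended at depth at most [start], then d >= 1 / Q, which contradicts d u Q
     < 1. *)
  have := avi ij; have [dS|plain] := start_or_plain ha hb ij => avd.
    have : 2 <= Q * dyad (depth (st i.+2)).
      rewrite /dyad ler_pdivlMr ?exprn_gt0// -exprS ler_eXn2l ?ltr1n//.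
      by move: r1 dS; clear; lia.
    have : Q * d * 1 <= Q * d * u by rewrite ler_wpM2l// mulr_ge0// ltW.
    have : Q * (dyad (depth (st i.+2)) / 2) <= Q * d by rewrite ler_pM2l.
    lra.
  (* If the resolving step is plain, only two splits separate the depths, so avoidance gives 4 u ^ 2
     d g ^ 2 >= 1. With d u Q < 1 this yields Q <= 4 u g ^ 2, then d Q ^ 2 <= 4 g ^ 2 <= Q ^ 2 lam /
     2. *)
  have ki : dyad (base_exp (st i)) <= dyad (depth (st i.+2)) * g ^+ 2.
    rewrite -ler_pdivrMr ?exprn_gt0//.
    rewrite -exprM -[_^-1]/(dyad _) -dyadD ler_dyad.
    have := hj i; have := hj i.+1; rewrite depthS plain depthS.
    by move: ij; clear; lia.
  have u3 : 1 <= 4 * (u * (u * d)) * g ^+ 2.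
    apply: le_trans ui _.
    have : u ^+ 2 * dyad (base_exp (st i)) <= u ^+ 2 * (dyad (depth (st i.+2)) * g ^+ 2).
      by rewrite ler_wpM2l// sqr_ge0.
    have : u ^+ 2 * g ^+ 2 * (dyad (depth (st i.+2)) / 2) <= u ^+ 2 * g ^+ 2 * d.
      by rewrite ler_wpM2l// mulr_ge0 ?sqr_ge0.
    lra.
  have dp : 0 < d by apply: lt_le_trans avd; rewrite divr_gt0// dyad_gt0.
  have Qu : Q <= 4 * u * g ^+ 2.
    have dQu : d * u * Q <= d * u * (4 * u * g ^+ 2) by lra.
    by move: dQu; rewrite ler_pM2l// mulr_gt0.
  have dQQ : d * Q * Q <= d * Q * (4 * u * g ^+ 2) by rewrite ler_pM2l// mulr_gt0.
  have dug : d * (u * Q) * g ^+ 2 <= 1 * g ^+ 2 by rewrite ler_wpM2r ?sqr_ge0// ltW.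
  have g20 : 0 < g ^+ 2 by rewrite !exprn_gt0.
  have dQ2 : d * Q ^+ 2 <= 4 * g ^+ 2 by lra.
  have Q20 : 0 < Q ^+ 2 by rewrite exprn_gt0.
  rewrite -(ler_pM2l Q20); lra.
(* The base has the fraction as an end and extends from it in the direction of the midpoint; kap <=
   lam / 2 keeps it inside. *)
have [py|py] := leP (p%:~R / q%:~R) y.
  exists (p%:~R / q%:~R); split; first by move: close; rewrite ler_norml /y => /andP[? ?]; lra.
  split; first by rewrite -/kap -/lam; move: py; rewrite /y; lra.
  exists p, q; split => // z; rewrite -/kap ler_norml => /andP[? ?]; apply/andP; split; lra.
exists (p%:~R / q%:~R - kap); split; first by move: py; rewrite /y; lra.
split; first by move: close; rewrite -/kap -/lam ler_norml /y => /andP[? ?]; lra.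
exists p, q; split => // z; rewrite -/kap ler_norml => /andP[? ?]; apply/andP; split; lra.
Qed.

End tree.

(** * The Cantor-like set *)

Section construction.
Variables (R : realType) (a b : R).

Local Notation st := (st a b).
Local Notation child_exp := (child_exp a b).
Local Notation dyad := (dyad R).
Local Notation left_end := (left_end a b).

Definition node (j t : nat) : R * R :=
  (left_end j t, left_end j t + dyad (depth (st j))).

Definition level_seq (j : nat) : seq (R * R) :=
  [seq node j t | t <- iota 0 (2 ^ mass (st j))].

Definition tree_level (j : nat) : {fset R * R} := seq_fset tt (level_seq j).

Lemma tree_levelP j I :
  reflect (exists2 t, (t < 2 ^ mass (st j))%N & I = node j t) (I \in tree_level j).
Proof.
rewrite /tree_level seq_fsetE; apply: (iffP mapP) => [[t]|[t tm ->]].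
  by rewrite mem_iota => tm ->; exists t.
by exists t; rewrite // mem_iota.
Qed.

Lemma closed_nodeE j t y : closed_itv (node j t) y =
  (left_end j t <= y <= left_end j t + dyad (depth (st j))) :> Prop.
Proof. by rewrite /closed_itv /= in_itv. Qed.

Lemma left_end_in_node j t : closed_itv (node j t) (left_end j t).
Proof. by rewrite closed_nodeE lexx lerDl ltW// dyad_gt0. Qed.

Lemma parent_lt j t : (t < 2 ^ mass (st j.+1))%N ->
  (t %/ 2 ^ child_exp (st j) < 2 ^ mass (st j))%N.
Proof. by rewrite massS expnD ltn_divLR ?expn_gt0. Qed.

Hypotheses (ha : 2 <= a) (hb : 0 <= b <= 2 / a).

Lemma node_subset_parent j t :
  closed_itv (node j.+1 t) `<=` closed_itv (node j (t %/ 2 ^ child_exp (st j))).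
Proof.
have [h1 h2] := left_end_nested ha hb j t.
move=> y; rewrite !closed_nodeE => /andP[h3 h4].
by rewrite (le_trans h1 h3) (le_trans h4 h2).
Qed.

Lemma child_spacing w x i i' : (i < i')%N ->
  child a w x i + 2 * next_length a w <= child a w x i'.
Proof.
move=> ii; rewrite /child.
have : (bump (bad_piece a w x) i).+1%:R <= (bump (bad_piece a w x) i')%:R :> R.
  by rewrite ler_nat ltnNge leq_bump2 -ltnNge.
by rewrite -natr1; have := next_length_gt0 a w; nra.
Qed.

(** Siblings are separated by a gap of their own length; for different parents the larger separation
    one level up applies. *)
Lemma node_separated j t t' y y' :
  (t < 2 ^ mass (st j))%N -> (t' < 2 ^ mass (st j))%N -> t != t' ->
  closed_itv (node j t) y -> closed_itv (node j t') y' ->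
  dyad (depth (st j)) <= `|y - y'|.
Proof.
elim: j t t' y y' => [|j IH] t t' y y' tm tm' tt' yt yt'.
  by move: tm tm' tt'; rewrite expn0 !ltnS !leqn0 => /eqP-> /eqP->; rewrite eqxx.
have [dt|dt] := eqVneq (t %/ 2 ^ child_exp (st j))%N (t' %/ 2 ^ child_exp (st j))%N.
  wlog ltt : t t' y y' tm tm' tt' yt yt' dt /
      (t %% 2 ^ child_exp (st j) < t' %% 2 ^ child_exp (st j))%N.
    move=> H.
    have [lt|lt|eqm] := ltngtP (t %% 2 ^ child_exp (st j)) (t' %% 2 ^ child_exp (st j)).
    - exact: H lt.
    - by rewrite distrC; apply: H lt => //; rewrite eq_sym.
    - by case/eqP: tt'; rewrite (divn_eq t (2 ^ child_exp (st j))) eqm dt -divn_eq.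
  have := child_spacing (st j) (left_end j (t %/ 2 ^ child_exp (st j))) ltt.
  move: yt yt'; rewrite !closed_nodeE /= -dt.
  rewrite !depthS -/(next_length a (st j)) => /andP[h1 h2] /andP[h3 h4] h5.
  by rewrite distrC ler_normr; apply/orP; left; lra.
apply: le_trans (IH _ _ _ _ (parent_lt tm) (parent_lt tm') dt
  (node_subset_parent yt) (node_subset_parent yt')).
by rewrite ler_dyad ltnW// (ltn_depth ha hb).
Qed.

Lemma node_inj j t t' :
  (t < 2 ^ mass (st j))%N -> (t' < 2 ^ mass (st j))%N ->
  closed_itv (node j t) `&` closed_itv (node j t') !=set0 -> t = t'.
Proof.
move=> tm tm' [y [yt yt']]; apply/eqP/negPn/negP => /node_separated sep.
have := sep _ _ _ tm tm' yt yt'.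
by rewrite subrr normr0 leNgt dyad_gt0.
Qed.

Lemma node_subset j t t' : (t < 2 ^ mass (st j.+1))%N -> (t' < 2 ^ mass (st j))%N ->
  (closed_itv (node j.+1 t) `<=` closed_itv (node j t')) <->
  (t %/ 2 ^ child_exp (st j))%N = t'.
Proof.
move=> tm tm'; split => [sub|<-]; last exact: node_subset_parent.
apply: (@node_inj j) => //; first exact: parent_lt.
exists (left_end j.+1 t); split; last exact/sub/left_end_in_node.
exact/node_subset_parent/left_end_in_node.
Qed.

Definition tree_nchild (k : nat) : nat := (2 ^ child_exp (st k.-1))%N.

Lemma tree_level0 : tree_level 0 = [fset (0, 1)]%fset.
Proof.
apply/fsetP => I; rewrite /tree_level seq_fsetE /= inE in_fset1.
by rewrite /node /= add0r dyad0.
Qed.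

Lemma tree_level_nondegenerate k (I : R * R) : I \in tree_level k -> I.1 < I.2.
Proof. by case/tree_levelP => t _ -> /=; rewrite ltrDl dyad_gt0. Qed.

Lemma tree_level_disjoint k : trivIset [set` tree_level k] (@closed_itv R).
Proof.
by move=> _ _ /= /tree_levelP[t tm ->] /tree_levelP[t' tm' ->] /(node_inj tm tm') ->.
Qed.

Lemma tree_level_nested k (J : R * R) : J \in tree_level k.+1 ->
  exists2 I : R * R, I \in tree_level k & closed_itv J `<=` closed_itv I.
Proof.
case/tree_levelP => t tm ->; exists (node k (t %/ 2 ^ child_exp (st k))).
  by apply/tree_levelP; exists (t %/ 2 ^ child_exp (st k))%N => //; exact: parent_lt.
exact: node_subset_parent.
Qed.

Lemma tree_nchild_gt0 k : (0 < tree_nchild k.+1)%N.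
Proof. by rewrite expn_gt0. Qed.

Lemma tree_level_nchild k (I : R * R) : I \in tree_level k ->
  #|` [fset J : R * R in tree_level k.+1
      | `[< (closed_itv J `<=` closed_itv I)%classic >]]%fset| = tree_nchild k.+1.
Proof.
case/tree_levelP => t tm ->.
set n := tree_nchild k.+1; have n0 : (0 < n)%N := tree_nchild_gt0 k.
pose s := [seq node k.+1 (t * n + i) | i <- iota 0 n].
have ltm i : (i < n)%N -> (t * n + i < 2 ^ mass (st k.+1))%N.
  move=> ni; rewrite massS expnD -/(tree_nchild k.+1) -/n.
  by apply: (@leq_trans (t.+1 * n)); rewrite ?leq_mul// mulSnr ltn_add2l.
have -> : [fset J : R * R in tree_level k.+1
      | `[< (closed_itv J `<=` closed_itv (node k t))%classic >]]%fset = seq_fset tt s.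
  apply/fsetP => J; rewrite seq_fsetE !inE /=; apply/andP/mapP.
    move=> [/tree_levelP[t' tm' ->] /asboolP /(node_subset tm' tm) tt'].
    exists (t' %% n)%N; first by rewrite mem_iota ltn_mod.
    by rewrite -tt' -divn_eq.
  move=> [i]; rewrite mem_iota /= => ni ->; split.
    by apply/tree_levelP; exists (t * n + i)%N => //; exact: ltm.
  apply/asboolP/node_subset => //; first exact: ltm.
  by rewrite divnMDl// divn_small ?addn0.
rewrite size_seq_fset undup_id ?size_map ?size_iota//.
rewrite map_inj_in_uniq ?iota_uniq// => i i'; rewrite !mem_iota /= => ni ni' E.
have : (t * n + i = t * n + i')%N; last by move/addnI.
apply: (@node_inj k.+1); rewrite ?ltm// E setIid.
by exists (left_end k.+1 (t * n + i')); exact: left_end_in_node.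
Qed.

Lemma cvg_dyad : dyad n @[n --> \oo] --> (0 : R).
Proof.
rewrite (_ : dyad = GRing.exp 2^-1); last by apply/funext => n; rewrite /dyad exprVn.
by apply: cvg_expr; rewrite gtr0_norm ?invf_lt1// ltr1n.
Qed.

Lemma tree_level_length :
  (\big[Order.max/0]_(J <- tree_level k) (J.2 - J.1)) @[k --> \oo] --> (0 : R).
Proof.
apply: (squeeze_cvgr _ (@cvg_cst _ _ _ _ _) cvg_dyad).
near=> k; rewrite bigmax_ge_id /=.
rewrite big_seq_cond; apply: bigmax_le; first exact/ltW/dyad_gt0.
move=> J; rewrite andbT => /tree_levelP[t _ ->] /=.
by rewrite addrAC subrr add0r ler_dyad (depth_geid ha hb).
Unshelve. all: by end_near.
Qed.

Definition tree_construction : cantor_construction R :=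
  CantorConstruction tree_level0 tree_level_nondegenerate tree_level_disjoint
    tree_level_nested tree_nchild_gt0 tree_level_nchild tree_level_length.

Lemma prod_tree_nchild k :
  (\prod_(1 <= j < k.+1) nchild tree_construction j = 2 ^ mass (st k))%N.
Proof.
elim: k => [|k IH]; first by rewrite big_geq.
by rewrite big_nat_recr//= IH massS expnD.
Qed.

Lemma cantor_setP x : cantor_set tree_construction x <->
  forall j, exists2 t, (t < 2 ^ mass (st j))%N & closed_itv (node j t) x.
Proof.
split => [H j|H j _].
  by have [_ /tree_levelP[t tm ->] xt] := H j I; exists t.
have [t tm xt] := H j; exists (node j t) => //; apply/tree_levelP; by exists t.
Qed.

Lemma cantor_set_subset : cantor_set tree_construction `<=` `[0, 1].
Proof.
move=> x /cantor_setP /(_ 0%N)[t _]; rewrite closed_nodeE /= add0r dyad0.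
by rewrite in_itv.
Qed.

End construction.

(** * Irrationality exponent *)

Lemma ltr_dyad_powR (R : realType) (q z : R) n : 0 < q ->
  (dyad R n < 1 / q `^ z) = (z * ln q < n%:R * ln 2).
Proof.
move=> q0; rewrite /dyad div1r ltf_pV2 ?posrE ?exprn_gt0 ?powR_gt0//.
by rewrite -[LHS]ltr_ln ?posrE ?exprn_gt0 ?powR_gt0// ln_powR lnXn// mulr_natl.
Qed.

Lemma finite_abs_le (n : nat) : finite_set [set p : int | `|p| <= n%:Z].
Proof.
apply: (sub_finite_set _ (finite_seq [seq i%:Z - n%:Z | i <- iota 0 (2 * n).+1])).
move=> p /= pn; suff : p \in [seq i%:Z - n%:Z | i <- iota 0 (2 * n).+1] by [].
apply/mapP; exists (absz (p + n%:Z)); last by lia.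
by rewrite mem_iota; lia.
Qed.

Lemma finite_fractions_near (R : realType) (x : R) (M : nat) :
  finite_set [set pq : int * int | 0 < pq.2 /\ pq.2%:~R <= M%:R :> R /\
    `|x - pq.1%:~R / pq.2%:~R| < 1].
Proof.
have [B HB] : exists B : nat, (`|x| + 1) * M%:R < B%:R.
  by exists (Num.truncn ((`|x| + 1) * M%:R)).+1; exact: truncnS_gt.
apply: (sub_finite_set _ (finite_setX (finite_abs_le B) (finite_abs_le M))).
move=> [p q] /= [q0 [qM near]].
have qr : 0 < q%:~R :> R by rewrite ltr0z.
split => /=; last by move: qM; rewrite (_ : M%:R = M%:Z%:~R)// ler_int; lia.
rewrite -(ler_int R) intr_norm -[leRHS]/(B%:R).
apply: le_trans (ltW HB).
have : `|p%:~R / q%:~R| <= `|x| + 1 :> R.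
  have := ler_distD x (p%:~R / q%:~R : R) 0; rewrite !subr0 distrC; lra.
rewrite normrM normfV (gtr0_norm qr) ler_pdivrMr// => h.
apply: (le_trans h); rewrite ler_wpM2l// addr_ge0//.
Qed.

Section exponent.
Variables (R : realType) (a b : R).

Local Notation st := (st a b).
Local Notation dyad := (dyad R).

Hypotheses (ha : 2 <= a) (hb : 0 <= b <= 2 / a).

Variable x : R.
Hypothesis xE : cantor_set (tree_construction ha hb) x.

Lemma resolved_far i (p u : int) : 0 < u ->
  2 * u%:~R ^+ 2 * dyad (base_exp a (st i)) < 1 ->
  dyad (depth (st i.+1)) / 2 <= `|x - p%:~R / u%:~R|.
Proof.
move=> u0 ui; have [t tm] := (cantor_setP ha hb x).1 xE i.+1.
rewrite closed_nodeE => xt.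
exact: left_end_avoids ha hb i.+1 t i p u x (ltnSn i) u0 ui xt.
Qed.

Lemma not_rational (p u : int) : 0 < u -> 0 < `|x - p%:~R / u%:~R|.
Proof.
move=> u0; have [i [ui _]] := first_resolved ha hb u0.
by apply: lt_le_trans (resolved_far p u0 ui); rewrite divr_gt0 ?dyad_gt0.
Qed.

Lemma jump_approximation j : jump (st j) -> exists p q : int, [/\ 0 < q,
  `|x - p%:~R / q%:~R| <= dyad (base_exp a (st j)) &
  dyad (base_exp a (st j)) < 1 / q%:~R `^ a].
Proof.
move=> jw; have [t tm] := (cantor_setP ha hb x).1 xE j.+1.
rewrite closed_nodeE => /andP[x1 x2].
set y := left_end a b j (t %/ 2 ^ child_exp a b (st j)).
have [_ [_ [p [q [q0 qr pq]]]]] : rational_base a (st j) y (base a (st j) y).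
  rewrite /base jw; apply: xgetPex.
  by apply: rational_base_nonempty => //; exact: left_end_avoids.
have lt : (t %% 2 ^ child_exp a b (st j) < 2 ^ child_exp a b (st j))%N.
  by rewrite ltn_pmod// expn_gt0.
have [c1 c2] := child_subinterval ha hb y lt.
exists p, q; split => //.
  apply: pq; move: x1 x2 c1 c2; rewrite depthS /= -/y /next_length => *.
  apply/andP; split; lra.
have q1 : 0 < q%:~R :> R by rewrite ltr0z.
rewrite ltr_dyad_powR//.
have [rz _ _] := base_exp_jump ha hb jw.
have l2 : 0 < ln 2 :> R by rewrite ln_gt0// ltr1n.
apply: (@le_lt_trans _ _ (a * ((denom_exp (st j))%:R * ln 2))); last first.
  by rewrite mulrA ltr_pM2r.
apply: ler_wpM2l; first by have a2 := ha; lra.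
rewrite mulr_natl -lnXn// ler_ln// posrE exprn_gt0//.
Qed.

(** Finitely many solutions would all keep some distance d > 0 from x, as x is irrational, but late
    jumps give solutions closer than d. *)
Lemma exponent_ge : (a%:E <= irrationality_exponent x)%E.
Proof.
apply: ereal_sup_ubound; exists a => //= /finite_seqP[s Es].
have good p q : 0 < q -> `|x - p%:~R / q%:~R| < 1 / q%:~R `^ a -> (p, q) \in s.
  by move=> q0 pq; have : [set` s] (p, q) by rewrite -Es /= pq not_rational.
have pos : {in s, forall pq, 0 < `|x - pq.1%:~R / pq.2%:~R|}.
  by move=> [p q] pqs; have : [set` s] (p, q) by []; rewrite -Es /= => -[_ /andP[]].
have [d d0 Hd] : exists2 d : R, 0 < d &
    {in s, forall pq, d <= `|x - pq.1%:~R / pq.2%:~R|}.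
  elim: (s) pos => [|c s' IH] pos; first by exists 1.
  have [|d d0 Hd] := IH; first by move=> pq h; apply: pos; rewrite inE h orbT.
  exists (Num.min d `|x - c.1%:~R / c.2%:~R|).
    by rewrite lt_min d0 pos// mem_head.
  move=> pq; rewrite inE => /orP[/eqP->|/Hd h]; first by rewrite ge_min lexx orbT.
  by rewrite ge_min h.
have [n nlt] := exists_dyad_lt (d^-1).
have [j nj jw] := jump_unbounded ha hb n.
have [p [q [q0 pq1 pq2]]] := jump_approximation jw.
have := Hd _ (good _ _ q0 (le_lt_trans pq1 pq2)); rewrite leNgt => /negP; apply.
apply: (le_lt_trans pq1); apply: (@le_lt_trans _ _ (dyad n)).
  by rewrite ler_dyad (leq_trans nj)// (base_exp_geid ha hb).
by move: nlt; rewrite mulrC ltr_pdivrMr// mul1r.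
Qed.

Lemma exponent_le : (irrationality_exponent x <= a%:E)%E.
Proof.
apply: ge_ereal_sup => _ [z /= inf <-]; rewrite lee_fin leNgt; apply/negP => az.
apply: inf.
have a2 := ha; pose d := (z - a) / 4; have d0 : 0 < d by rewrite /d; lra.
have [j0 H] := base_exp_growth ha hb d0.
have l2 : 0 < ln 2 :> R by rewrite ln_gt0// ltr1n.
(* For z = a + 4 d, a solution with denominator q resolved late satisfies z ln q < (a / 2 + d) (ln 2
   + 2 ln q), that is ln q < C. The other summand of [M] covers the denominators resolved by step
   [j0]. *)
pose C := (a / 2 + d) * ln 2 / (2 * d).
pose M := (Num.truncn (expR C) + 2 ^ base_exp a (st j0)).+1.
apply: (sub_finite_set _ (finite_fractions_near x M)) => -[p q] /= [q0 /andP[_ lt]].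
have q1 : 1 <= q%:~R :> R by rewrite ler1z.
have qp : 0 < q%:~R :> R by lra.
split => //; split; last first.
  apply: (lt_le_trans lt); rewrite div1r invf_le1 ?powR_gt0//.
  by rewrite -[leLHS](powRr0 q%:~R) ler_powR//; lra.
have [i [i1 i2]] := first_resolved ha hb q0.
have [j0i|ij0] := leqP j0 i; last first.
  have : 2 * q%:~R ^+ 2 * dyad (base_exp a (st j0)) < 1.
    apply: le_lt_trans i1; apply: ler_wpM2l; first by rewrite mulr_ge0 ?sqr_ge0.
    by rewrite ler_dyad leq_base.
  rewrite /dyad ltr_pdivrMr ?exprn_gt0// mul1r -natrX => h.
  apply: (@le_trans _ _ (2 ^ base_exp a (st j0))%:R); first by nra.
  by rewrite ler_nat /M leqW// leq_addl.
have far := resolved_far p q0 i1.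
have := le_lt_trans far lt; rewrite -dyadS ltr_dyad_powR// => up.
have low : (base_exp a (st i))%:R * ln 2 <= ln 2 + 2 * ln q%:~R :> R.
  move: i2; rewrite /dyad ler_pdivlMr ?exprn_gt0// mul1r => i2.
  have : ln (2 ^+ base_exp a (st i)) <= ln (2 * q%:~R ^+ 2) :> R.
    by rewrite ler_ln ?posrE ?mulr_gt0 ?exprn_gt0.
  have -> : ln (2 * q%:~R ^+ 2) = ln 2 + 2 * ln q%:~R :> R.
    by rewrite lnM ?posrE ?exprn_gt0// [ln (_ ^+ 2)]lnXn// mulr_natl.
  by rewrite lnXn// -[ln 2 *+ _]mulr_natl.
have : ln q%:~R <= C :> R.
  have := H i j0i; rewrite natr1 => gr.
  rewrite /C ler_pdivlMr; last by rewrite pmulr_lgt0.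
  have : (depth (st i.+2)).+1%:R * ln 2 <= (a / 2 + d) * (base_exp a (st i))%:R * ln 2.
    by rewrite ler_wpM2r// ltW.
  have : (a / 2 + d) * ((base_exp a (st i))%:R * ln 2) <= (a / 2 + d) * (ln 2 + 2 * ln q%:~R).
    by rewrite ler_wpM2l//; lra.
  move: up; rewrite (_ : z = a + 4 * d); last by rewrite /d; field.
  lra.
move=> lnq; have : expR (ln q%:~R) <= expR C by rewrite ler_expR.
rewrite lnK ?posrE// => h; apply: (le_trans h).
apply/ltW/(lt_le_trans (truncnS_gt _)).
by rewrite ler_nat /M ltnS leq_addr.
Qed.

Lemma irrationality_exponent_cantor_set : irrationality_exponent x = a%:E.
Proof. by apply/eqP; rewrite eq_le exponent_ge exponent_le. Qed.

End exponent.

(** * Uniform measure *)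

Section uniform_measure.
Variables (R : realType) (a b : R).

Local Notation st := (st a b).
Local Notation child_exp := (child_exp a b).
Local Notation dyad := (dyad R).
Local Notation left_end := (left_end a b).

(* The cap by the last index makes this total: t <= 0 is sent to the first
   interval and t >= 1 to the last one. *)
Definition address (j : nat) (t : R) : nat :=
  minn (Num.truncn (t * 2 ^+ mass (st j))) (2 ^ mass (st j)).-1.

Lemma address_lt j t : (address j t < 2 ^ mass (st j))%N.
Proof. by rewrite /address gtn_min orbC prednK ?leqnn// expn_gt0. Qed.

(** Integer parts satisfy floor (s n) %/ n = floor s, and the caps match because (N n - 1) %/ n = N
    - 1. *)
Lemma address_parent j t : (address j.+1 t %/ 2 ^ child_exp (st j) = address j t)%N.
Proof.
set n := (2 ^ child_exp (st j))%N; set N := (2 ^ mass (st j))%N.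
have n0 : (0 < n)%N by rewrite expn_gt0.
have N0 : (0 < N)%N by rewrite expn_gt0.
have trunc_div (s : R) : (Num.truncn (s * n%:R) %/ n)%N = Num.truncn s.
  have nr : 0 < n%:R :> R by rewrite ltr0n.
  have [s0|s0] := ltP s 0.
    have tr0 (u : R) : u < 0 -> Num.truncn u = 0%N.
      by move=> u0; rewrite truncn_floor leNgt u0.
    by rewrite !tr0 ?div0n// pmulr_llt0.
  apply/esym/truncn_def.
  have /andP[h1 h2] := truncn_itv (mulr_ge0 s0 (ltW nr)).
  have := ltn_ceil (Num.truncn (s * n%:R)) n0.
  have := leq_divM (Num.truncn (s * n%:R)) n.
  move: (Num.truncn _) h1 h2 => k h1 h2 h3 h4.
  apply/andP; split.
    rewrite -(ler_pM2r nr) -natrM; apply: le_trans h1; by rewrite ler_nat.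
  rewrite -(ltr_pM2r nr) -natrM; apply: (lt_le_trans h2); by rewrite ler_nat.
rewrite /address massS exprD mulrA -[2 ^+ child_exp _]natrX -/n.
rewrite expnD -/N -/n -(trunc_div (t * _)).
move: (Num.truncn _) => k; rewrite /minn.
have E : ((N * n).-1 %/ n = N.-1)%N.
  apply/eqP; rewrite eqn_leq -ltnS prednK// ltn_divLR// leq_divRL//.
  rewrite prednK ?muln_gt0 ?N0// leqnn /=.
  by rewrite -ltnS prednK ?muln_gt0 ?N0// ltn_pmul2r// prednK.
have [h|h] := ltnP k (N * n).-1.
  have := leq_div2r n (ltnW h); rewrite E.
  by case: ltnP => // h1 h2; apply/eqP; rewrite eqn_leq h1 h2.
have := leq_div2r n h; rewrite E.
by case: ltnP => // h1 h2; apply/eqP; rewrite eqn_leq h2 ltnW.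
Qed.

Lemma measurable_address j i :
  measurable [set t : measurableTypeR R | address j t = i].
Proof.
have mle k : measurable [set t : measurableTypeR R | (k <= address j t)%N].
  rewrite /address; have [kN|kN] := leqP k (2 ^ mass (st j)).-1; last first.
    rewrite (_ : [set _ | _] = set0)//; apply/seteqP; split => // t /=.
    by rewrite leq_min => /andP[_]; rewrite leqNgt kN.
  case: k kN => [|k] kN.
    by rewrite (_ : [set _ | _] = setT)//; apply/seteqP; split.
  rewrite (_ : [set _ | _] = `[k.+1%:R / 2 ^+ mass (st j), +oo[%classic); last first.
    apply/seteqP; split => t /=; rewrite leq_min kN andbT in_itv /= ?andbT;
      by rewrite truncn_gt_nat ler_pdivrMr ?exprn_gt0.
  exact: measurable_itv.
rewrite (_ : [set _ | _] = [set t | (i <= address j t)%N] `\`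
    [set t | (i.+1 <= address j t)%N]); first exact: measurableD.
apply/seteqP; split => t /=; first by move=> <-; rewrite leqnn ltnn.
by move=> [h1 /negP]; rewrite -leqNgt => h2; apply/eqP; rewrite eqn_leq h2 h1.
Qed.

Lemma uniform_prob_address j i : (i < 2 ^ mass (st j))%N ->
  uniform_prob (@ltr01 R) [set t | address j t = i] = ((2 ^ mass (st j))%N%:R^-1)%:E.
Proof.
move=> iN; set N := (2 ^ mass (st j))%N in iN *.
have N0 : 0 < N%:R :> R by rewrite ltr0n expn_gt0.
rewrite /uniform_prob integral_uniform_pdf.
set U := [set t | _] `&` _.
rewrite (eq_integral (fun=> 1%E)); last first.
  move=> t; rewrite inE => -[_ /=]; rewrite in_itv/= /uniform_pdf => ->.
  by rewrite subr0 invr1.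
have mU : measurable U by apply: measurableI => //; exact: measurable_address.
rewrite integral_cst// mul1e.
(* The fibre lies between the open and the closed interval with ends i / N and (i + 1) / N; for the
   last index the cap adds the point t = 1. *)
have len (l r : bool) : lebesgue_measure
    [set` Interval (BSide l (i%:R / N%:R)) (BSide r (i.+1%:R / N%:R : R))] = (N%:R^-1)%:E.
  rewrite lebesgue_measure_itv /= lte_fin ltr_pM2r ?invr_gt0// ltr_nat ltnSn.
  by rewrite -EFinB -mulrBl -natr1 addrAC subrr add0r mul1r.
have NE : 2 ^+ mass (st j) = N%:R :> R by rewrite natrX.
apply/eqP; rewrite eq_le; apply/andP; split.
  rewrite -(len true false); apply: le_measure; rewrite ?inE//.
  move=> t [/= ad]; rewrite !in_itv/= => /andP[t0 t1].
  have /andP[h1 h2] := truncn_itv (mulr_ge0 t0 (ltW N0)).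
  move: ad; rewrite /address NE -/N ler_pdivrMr// ler_pdivlMr// /minn.
  case: ltnP => h <-; first by rewrite h1 ltW.
  rewrite prednK ?expn_gt0// -[X in _ && (_ <= X)]mul1r ler_pM2r// t1 andbT.
  by apply: le_trans h1; rewrite ler_nat.
rewrite -(len false true); apply: le_measure; rewrite ?inE//.
move=> t /=; rewrite !in_itv/= => /andP[]; rewrite ltr_pdivrMr// ltr_pdivlMr// => h1 h2.
have t0 : 0 < t by rewrite -(pmulr_lgt0 t N0); apply: le_lt_trans h1.
split => /=.
  rewrite /address NE (@truncn_def _ _ i); last by rewrite ltW.
  by apply/minn_idPl; rewrite -ltnS prednK// expn_gt0.
rewrite in_itv/= ltW//= -(ler_pM2r N0) mul1r; apply/ltW/(lt_le_trans h2).
by rewrite ler_nat.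
Qed.

Hypotheses (ha : 2 <= a) (hb : 0 <= b <= 2 / a).

Definition cantor_map (t : R) : R := limn (fun j => left_end j (address j t)).

Lemma node_address j k t : (j <= k)%N ->
  closed_itv (node a b k (address k t)) `<=` closed_itv (node a b j (address j t)).
Proof.
elim: k => [|k IH]; first by rewrite leqn0 => /eqP->.
rewrite leq_eqVlt => /orP[/eqP->//|]; rewrite ltnS => /IH.
by apply: subset_trans; rewrite -(address_parent k t); exact: node_subset_parent.
Qed.

Lemma left_end_address_nondecreasing t :
  {homo (fun j => left_end j (address j t)) : j k / (j <= k)%N >-> j <= k}.
Proof.
move=> j k jk /=; have := @node_address _ _ t jk _ (left_end_in_node a b k (address k t)).
by rewrite closed_nodeE => /andP[].
Qed.

Lemma cvg_cantor_map t : left_end j (address j t) @[j --> \oo] --> cantor_map t.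
Proof.
apply: (nondecreasing_is_cvgn (left_end_address_nondecreasing t)).
exists (left_end 0 0 + dyad 0) => _ [j _ <-].
have := @node_address _ _ t (leq0n j) _ (left_end_in_node a b j (address j t)).
by rewrite closed_nodeE => /andP[].
Qed.

Lemma cantor_map_in_node j t : closed_itv (node a b j (address j t)) (cantor_map t).
Proof.
have cv := @cvg_cantor_map t.
have sub k : (j <= k)%N -> left_end j (address j t) <= left_end k (address k t)
    <= left_end j (address j t) + dyad (depth (st j)).
  move=> jk; have := @node_address _ _ t jk _ (left_end_in_node a b k (address k t)).
  by rewrite closed_nodeE.
rewrite closed_nodeE; apply/andP; split.
  apply: limr_ge; first by apply: cvgP cv.
  by exists j => // k /= /sub /andP[].
apply: limr_le; first by apply: cvgP cv.
by exists j => // k /= /sub /andP[].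
Qed.

(** A pointwise limit of functions that depend on t only through its address, whose fibres are
    measurable. *)
Lemma measurable_cantor_map :
  measurable_fun setT (cantor_map : measurableTypeR R -> measurableTypeR R).
Proof.
apply: (measurable_realfun.measurable_fun_cvg
  (h := fun j t => left_end j (address j t))); last first.
  by move=> t _; exact: cvg_cantor_map.
move=> j _ Y mY; rewrite setTI.
rewrite (_ : _ @^-1` Y = \bigcup_(i in [set i | Y (left_end j i)])
    [set t | address j t = i]); last first.
  apply/seteqP; split => t /=; first by move=> h; exists (address j t).
  by move=> [i /= Yi] ->.
apply: bigcup_measurable => i _; exact: measurable_address.
Qed.

HB.instance Definition _ := isMeasurableFun.Build _ _ _ _
  (cantor_map : measurableTypeR R -> measurableTypeR R) measurable_cantor_map.

Lemma uniform_measure_exists : exists mu : probability (measurableTypeR R) R,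
  is_uniform_measure (tree_construction ha hb) mu.
Proof.
exists (distribution (uniform_prob (@ltr01 R))
  (cantor_map : {mfun measurableTypeR R >-> measurableTypeR R})).
split.
  rewrite /distribution /pushforward /=.
  rewrite (_ : _ @^-1` _ = set0) ?measure0//.
  apply/seteqP; split => // t /=; apply; apply/cantor_setP => j.
  exists (address j t); [exact: address_lt|exact: cantor_map_in_node].
move=> k J k0 /tree_levelP[i iN ->]; rewrite prod_tree_nchild.
rewrite /distribution /pushforward /=.
rewrite (_ : _ @^-1` _ = [set t | address k t = i]) ?uniform_prob_address//.
apply/seteqP; split => t /=; last by move=> <-; exact: cantor_map_in_node.
move=> h; apply: (@node_inj _ a b ha hb k); rewrite ?address_lt//.
by exists (cantor_map t); split => //; exact: cantor_map_in_node.
Qed.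

End uniform_measure.

(** * Hausdorff dimension *)

Lemma le_hausdorff_content (R : realType) (s d d' : R) (X : set R) : d <= d' ->
  (hausdorff_content s d' X <= hausdorff_content s d X)%E.
Proof.
move=> dd'; apply: ereal_inf_le_tmp => S [D [c [r [rd XD ->]]]].
exists D, c, r; split => // j /rd /andP[r0 rd0].
by rewrite r0 (lt_le_trans rd0).
Qed.

Lemma hausdorff_measure_ge (R : realType) (s d : R) (X : set R) (M : \bar R) :
  0 < d -> (M <= hausdorff_content s d X)%E -> (M <= hausdorff_measure s X)%E.
Proof.
move=> d0 Md; apply: lime_ge.
  apply: nonincreasing_at_right_is_cvge.
  near=> r => x y _ _; exact: le_hausdorff_content.
near=> r; apply: (le_trans Md); apply: le_hausdorff_content.
by near: r; exact: nbhs_right_le.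
Unshelve. all: by end_near.
Qed.

Lemma hausdorff_measure_eq0 (R : realType) (s : R) (X : set R) :
  (forall d, 0 < d -> hausdorff_content s d X = 0%E) -> hausdorff_measure s X = 0%E.
Proof.
move=> H; apply: cvg_lim => //; apply: cvg_near_cst.
near=> d; apply: H; near: d; exact: nbhs_right_gt.
Unshelve. all: by end_near.
Qed.

(** By countable subadditivity the balls of a cover carry the full mass 1, and each carries at most
    the power s of its diameter. *)
Lemma mass_distribution (R : realType) (mu : probability (measurableTypeR R) R)
    (E : set R) (s d0 : R) :
  measurable (E : set (measurableTypeR R)) -> mu (~` E) = 0%E ->
  (forall c d : R, 0 < d < d0 -> (mu (ball c (d / 2)) <= (d `^ s)%:E)%E) ->
  (1 <= hausdorff_content s d0 E)%E.
Proof.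
move=> mE E0 H; apply: le_ereal_inf_tmp => _ [D [c [d [dd ED ->]]]].
pose F j : set (measurableTypeR R) := if j \in D then ball (c j) (d j / 2) else set0.
have mF j : measurable (F j).
  by rewrite /F; case: ifP => // _; exact: measurable_realfun.measurable_ball.
have sub : E `<=` \bigcup_j F j.
  move=> x /ED[j Dj xj]; exists j => //.
  by rewrite /F (_ : j \in D)//; apply/mem_set.
have E1 : (1 <= mu E)%E.
  rewrite -(probability_setT mu) -(setUv E) -[leRHS]adde0 -E0.
  by apply: measureU2 => //; exact: measurableC.
apply: (le_trans E1); apply: (le_trans (measure_sigma_subadditive mu mF mE sub)).
rewrite nneseries_esumT; last by move=> n; exact: measure_ge0.
rewrite [leRHS]esum_mkcond; apply: le_esum => j _; rewrite /F.
case: ifPn => [/set_mem Dj|_]; last by rewrite measure0.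
by apply: H; exact: dd.
Qed.

Lemma powR_dyad (R : realType) (s : R) n :
  dyad R n `^ s = expR (- (s * n%:R * ln 2)).
Proof.
rewrite /powR gt_eqF ?dyad_gt0// /dyad lnV ?posrE ?exprn_gt0// lnXn//.
by rewrite -[ln 2 *+ n]mulr_natl; congr expR; ring.
Qed.

Lemma dyad_expR (R : realType) n : dyad R n = expR (- (n%:R * ln 2)).
Proof. by rewrite -[LHS]powRr1 ?powR_dyad ?mul1r// ltW// dyad_gt0. Qed.

Section dimension.
Variables (R : realType) (a b : R).

Local Notation st := (st a b).
Local Notation dyad := (dyad R).

Hypotheses (ha : 2 <= a) (hb : 0 <= b <= 2 / a).

Local Notation C := (tree_construction ha hb).

Lemma measurable_cantor_set : measurable (cantor_set C : set (measurableTypeR R)).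
Proof.
apply: bigcap_measurable; first by exists 0%N.
move=> k _.
apply: fin_bigcup_measurable; first exact: finite_fset.
by move=> J _; exact: measurable_itv.
Qed.

(** Two points of an open ball are at distance less than d, while distinct level-j intervals are at
    least their length apart, so the ball meets only one of them. *)
Lemma ball_mass (mu : probability (measurableTypeR R) R) j (c d : R) :
  is_uniform_measure C mu -> (0 < j)%N -> d <= dyad (depth (st j)) ->
  (mu (ball c (d / 2)) <= (dyad (mass (st j)))%:E)%E.
Proof.
move=> [mu0 muJ] j0 dj.
have mE := measurable_cantor_set.
have mB : measurable (ball c (d / 2) : set (measurableTypeR R)).
  exact: measurable_realfun.measurable_ball.
have [[y [yB yE]]|noE] := pselect (exists y, ball c (d / 2) y /\ cantor_set C y); last first.
  apply: (@le_trans _ _ 0%E); last by rewrite lee_fin ltW// dyad_gt0.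
  rewrite -mu0; apply: le_measure; rewrite ?inE//; first exact: measurableC.
  by move=> y yB yE; apply: noE; exists y.
have [t tm yt] := (cantor_setP ha hb y).1 yE j.
have nodeL : node a b j t \in level C j by apply/tree_levelP; exists t.
have mJ : measurable (closed_itv (node a b j t) : set (measurableTypeR R)).
  exact: measurable_itv.
have := muJ j _ j0 nodeL; rewrite prod_tree_nchild natrX => muN.
rewrite /dyad -muN -[leRHS]adde0 -mu0.
apply: le_trans (_ : mu (closed_itv (node a b j t) `|` ~` cantor_set C) <= _)%E; last first.
  by apply: measureU2 => //; exact: measurableC.
apply: le_measure; rewrite ?inE//; first by apply: measurableU => //; exact: measurableC.
move=> z zB; have [zE|] := pselect (cantor_set C z); last by right.
left; have [t' tm' zt'] := (cantor_setP ha hb z).1 zE j.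
have [<-//|tt'] := eqVneq t' t.
have := node_separated ha hb tm' tm tt' zt' yt.
move: zB yB; rewrite -!ball_normE /= => zB yB sep.
have := ler_distD c z y; rewrite [X in _ <= X + _]distrC; lra.
Qed.

Lemma hausdorff_measure_pos s : 0 <= s < b ->
  (1 <= hausdorff_measure s (cantor_set C))%E.
Proof.
move=> sb; have [j0 H] := mass_lower ha hb sb.
have [mu Hmu] := uniform_measure_exists ha hb.
apply: (@hausdorff_measure_ge _ _ (dyad (depth (st j0.+1)))); first exact: dyad_gt0.
apply: (@mass_distribution _ mu) => //; first exact: measurable_cantor_set.
  by case: Hmu.
move=> c d /andP[d0 dj0].
have ex : exists k, dyad (depth (st k)) < d.
  have [n nd] := exists_dyad_lt d^-1; exists n.
  apply: (@le_lt_trans _ _ (dyad n)); first by rewrite ler_dyad (depth_geid ha hb).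
  by move: nd; rewrite mulrC ltr_pdivrMr// mul1r.
(* The least such level is k + 1, so d lies between the lengths of levels k + 1 and k. *)
case: (ex_minnP ex) => -[|k] kd mink.
  by move: (lt_trans kd dj0); rewrite ltr_dyad.
have jk : (j0 < k)%N.
  have := lt_trans kd dj0; rewrite ltr_dyad ltnNge => h.
  rewrite ltnNge; apply/negP => kj; case/negP: h.
  move: kj; rewrite leq_eqVlt => /orP[/eqP->//|kj].
  by apply/ltnW/(ltn_depth ha hb).
have dk : d <= dyad (depth (st k)).
  by rewrite leNgt; apply/negP => /mink; rewrite ltnn.
apply: (le_trans (ball_mass c Hmu (leq_trans _ jk) dk)) => //.
rewrite lee_fin dyad_expR.
apply: (@le_trans _ _ (dyad (depth (st k.+1)) `^ s)); last first.
  case/andP: sb => s0 _; apply: ge0_ler_powR => //; last exact: ltW.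
    by rewrite nnegrE ltW// dyad_gt0.
  by rewrite nnegrE ltW.
rewrite powR_dyad ler_expR lerN2 ler_wpM2r ?ln_ge0 ?ler1n//.
by apply: H; exact: ltnW.
Qed.

Lemma hausdorff_measure_zero s : b < s -> hausdorff_measure s (cantor_set C) = 0%E.
Proof.
move=> bs; apply: hausdorff_measure_eq0 => d d0.
have b0 : 0 <= b by case/andP: hb.
have s0 : 0 < s by lra.
have l2 : 0 < ln 2 :> R by rewrite ln_gt0// ltr1n.
apply/eqP; rewrite eq_le; apply/andP; split; last first.
  apply: le_ereal_inf_tmp => _ [D [c [r [_ _ ->]]]].
  by apply: esum_ge0 => j _; rewrite lee_fin powR_ge0.
apply/lee_addgt0Pr => eps eps0; rewrite add0e.
have [n nd] := exists_dyad_lt (4 * d^-1).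
(* The first entry makes the diameters smaller than d, the second makes the sum 2 ^ mass (4 2 ^-
   depth) ^ s at most eps. The factor 4 lets open balls centred at the left ends contain the closed
   intervals. *)
pose M := Num.max (s * n%:R) (2 * s - ln eps / ln 2).
have [j Hj] := mass_upper ha hb M bs.
pose r := 4 * dyad (depth (st j)).
have r0 : 0 < r by rewrite mulr_gt0// dyad_gt0.
apply: ereal_inf_le; exists (\esum_(t in `I_(2 ^ mass (st j))) (r `^ s)%:E)%E.
  exists `I_(2 ^ mass (st j)), (fun t => left_end a b j t), (fun=> r); split => //.
  - move=> t _; rewrite r0 /=.
    have nj : (n <= depth (st j))%N.
      rewrite -(ler_nat R) -(ler_pM2l s0); apply: le_trans Hj.
      apply: (@le_trans _ _ M); first by rewrite le_max lexx.
      by rewrite lerDr.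
    apply: (@le_lt_trans _ _ (4 * dyad n)); first by rewrite /r ler_pM2l// ler_dyad.
    by move: nd; rewrite mulrAC ltr_pdivrMr// mul1r.
  - move=> x /cantor_setP /(_ j)[t tm]; rewrite closed_nodeE => /andP[x1 x2].
    exists t => //; rewrite -ball_normE /= /r.
    have := dyad_gt0 R (depth (st j)); rewrite ltr_norml => e0.
    apply/andP; split; lra.
rewrite esum_fset; [|exact: finite_II|by move=> *; rewrite lee_fin powR_ge0].
rewrite -fsbig_ord sumEFin lee_fin sumr_const card_ord.
have -> : r `^ s = expR (s * (2 * ln 2 - (depth (st j))%:R * ln 2)).
  rewrite /powR gt_eqF// /r; congr (expR (s * _)).
  rewrite dyad_expR lnM ?posrE ?expR_gt0// expRK; congr (_ + _).
  by rewrite (_ : 4 = 2 ^+ 2 :> R) ?lnXn// -?natrX// mulr_natl.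
rewrite -[_ *+ (2 ^ _)]mulr_natr natrX -[2 ^+ _]lnK ?posrE ?exprn_gt0// lnXn// -expRD.
rewrite -[leRHS]lnK ?posrE// ler_expR -[ln 2 *+ _]mulr_natl.
have : 2 * s - ln eps / ln 2 <= M by rewrite le_max lexx orbT.
move=> M1; have : (2 * s - ln eps / ln 2) * ln 2 <=
    (s * (depth (st j))%:R - (mass (st j))%:R) * ln 2.
  by rewrite ler_pM2r//; lra.
rewrite mulrBl divfK ?gt_eqF//; lra.
Qed.

Lemma hausdorff_dimension_cantor_set : hausdorff_dimension (cantor_set C) = b%:E.
Proof.
have b0 : 0 <= b by case/andP: hb.
apply/eqP; rewrite eq_le; apply/andP; split.
  apply/lee_addgt0Pr => eps eps0; rewrite -EFinD.
  apply: ereal_inf_lbound; exists (b + eps) => //; split; first by rewrite addr_ge0// ltW.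
  by apply: hausdorff_measure_zero; rewrite ltrDl.
apply: le_ereal_inf_tmp => _ [s [s0 Hs] <-]; rewrite lee_fin leNgt; apply/negP => sb.
have := @hausdorff_measure_pos s; rewrite s0 sb Hs => /(_ isT).
by rewrite lee_fin ler10.
Qed.

End dimension.

Theorem theorem1 (R : realType) (a : R) (ha : 2 <= a)
    (b : R) (hb : 0 <= b <= 2 / a) :
  exists C : cantor_construction R,
    [/\ cantor_set C `<=` `[0, 1],
        hausdorff_dimension (cantor_set C) = b%:E,
        (exists mu : probability (measurableTypeR R) R,
           is_uniform_measure C mu)
      & forall mu : probability (measurableTypeR R) R,
          is_uniform_measure C mu ->
          {ae mu, forall x : R, irrationality_exponent x = a%:E}].
Proof.
exists (tree_construction ha hb); split.
- exact: cantor_set_subset.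
- exact: hausdorff_dimension_cantor_set.
- exact: uniform_measure_exists.
move=> mu [mu0 _]; exists (~` cantor_set (tree_construction ha hb)).
split => //; first by apply: measurableC; exact: (measurable_cantor_set ha hb).
move=> x /= nx xE; apply: nx; exact: irrationality_exponent_cantor_set xE.
Qed.
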